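(* Let $\mathcal{R}$ be the union of all proper retracts of a group $G$. (i) If $G$ is a free group of rank $n\geq 2$, then $$\overline{\rho}_X(\mathcal{R}) \leq 1 - \frac{1}{(2^{n+1}(2^n-1)+1)\,|B_X(3n-2)|}$$ for every finite generating set $X$ of $G$. (ii) If $G$ is a non-orientable surface group of genus $n \geq 3$, then $$\overline{\rho}_X(\mathcal{R}) \leq 1 - \frac{1}{6^{n-1}\,|B_X(5n-5)|}$$ for every finite generating set $X$ of $G$. (iii) If $G$ is an orientable surface group of genus $n \geq 2$, then $$\overline{\rho}_X(\mathcal{R}) \leq 1 - \frac{1}{|B_X(161n+8 \cdot 25^n(n-1)(16n+1)+33)|^2}$$ for every finite generating set $X$ of $G$.
   Context: The orientable surface group of genus $n$ is $\langle x_1,\dots,x_{2n}\mid [x_1,x_2]\cdots[x_{2n-1},x_{2n}]\rangle$; the non-orientable surface group of genus $n$ is $\langle x_1,\dots,x_n\mid x_1^2\cdots x_n^2\rangle$. A retract of a group $G$ is a subgroup $R\le G$ for which there exists a homomorphism $r:G\to R$ (a retraction) with $r(g)=g$ for all $g\in R$; it is proper if $R\ne G$. For a finitely generated group $G$ with finite generating set $X$ and $g\in G$, $|g|_X$ denotes the smallest integer $k\ge 0$ for which there exist $x_1,\dots,x_k\in X^{\pm1}$ with $g=x_1\cdots x_k$; the word metric is $d_X(g,h)=|g^{-1}h|_X$, and $B_X(r)$ is the ball of radius $r\ge 0$ centered at the identity in $(G,d_X)$, i.e. $B_X(r)=\{g\in G\mid |g|_X\le r\}$. The asymptotic density of $S\subseteq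 G$ with respect to $X$ is $$\overline{\rho}_X(S)=\limsup_{k\to\infty}\frac{|S\cap B_X(k)|}{|B_X(k)|}.$$ *)

(* Defs.v *)
From HB Require Import structures.
From mathcomp Require Import all_boot all_order all_algebra finmap.
From mathcomp Require Import all_classical all_reals all_analysis.

Set Implicit Arguments.
Unset Strict Implicit.
Unset Printing Implicit Defensive.

Import Order.TTheory GRing.Theory Num.Theory.

Local Open Scope classical_set_scope.
Local Open Scope group_scope.

(* The letter (i, false) stands for x_i and (i, true) for x_i^-1. *)
Definition word (m : nat) : Type := seq ('I_m * bool).

Definition eval_letter (G : groupType) (m : nat) (x : 'I_m -> G)
  (l : 'I_m * bool) : G := if l.2 then (x l.1)^-1 else x l.1.

Definition eval_word (G : groupType) (m : nat) (x : 'I_m -> G) (w : word m) : G :=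
  \prod_(l <- w) eval_letter x l.

(* Congruence on words whose quotient is the group
   < x_0, ..., x_(m-1) | rels >. *)
Inductive pres_eq (m : nat) (rels : seq (word m)) : word m -> word m -> Prop :=
| pres_refl w : pres_eq rels w w
| pres_sym w1 w2 : pres_eq rels w1 w2 -> pres_eq rels w2 w1
| pres_trans w1 w2 w3 :
    pres_eq rels w1 w2 -> pres_eq rels w2 w3 -> pres_eq rels w1 w3
| pres_cat u v w1 w2 :
    pres_eq rels w1 w2 -> pres_eq rels (u ++ w1 ++ v) (u ++ w2 ++ v)
| pres_cancel i b : pres_eq rels [:: (i, b); (i, ~~ b)] [::]
| pres_rel r : r \in rels -> pres_eq rels r [::].

(* Evaluation at x induces an isomorphism < x_0, ..., x_(m-1) | rels > -> G. *)
Definition presented_by (G : groupType) (m : nat) (rels : seq (word m))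
    (x : 'I_m -> G) : Prop :=
  (forall g : G, exists w : word m, eval_word x w = g) /\
  (forall w1 w2 : word m,
     eval_word x w1 = eval_word x w2 <-> pres_eq rels w1 w2).

Definition has_presentation (G : groupType) (m : nat) (rels : seq (word m)) : Prop :=
  exists x : 'I_m -> G, presented_by rels x.

Definition is_free_of_rank (G : groupType) (n : nat) : Prop :=
  @has_presentation G n [::].

(* x_1^2 ... x_n^2 (generators are numbered from 0) *)
Definition squares_word (n : nat) : word n :=
  flatten [seq [:: (i, false); (i, false)] | i <- enum 'I_n].

Definition is_nonorientable_surface_group (G : groupType) (n : nat) : Prop :=
  has_presentation G [:: squares_word n].

Lemma ord_even_proof (n : nat) (i : 'I_n) : i.*2 < n.*2.
Proof. by rewrite ltn_double. Qed.

Lemma ord_odd_proof (n : nat) (i : 'I_n) : i.*2.+1 < n.*2.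
Proof. by rewrite ltn_Sdouble. Qed.

Definition ord_even (n : nat) (i : 'I_n) : 'I_n.*2 := Ordinal (ord_even_proof i).
Definition ord_odd (n : nat) (i : 'I_n) : 'I_n.*2 := Ordinal (ord_odd_proof i).

(* [a, b] = a^-1 b^-1 a b, as in MathComp; the other usual convention
   a b a^-1 b^-1 gives an isomorphic surface group (invert the generators). *)
Definition comm_word (m : nat) (a b : 'I_m) : word m :=
  [:: (a, true); (b, true); (a, false); (b, false)].

(* [x_1, x_2] ... [x_(2n-1), x_(2n)] (generators are numbered from 0) *)
Definition commutators_word (n : nat) : word n.*2 :=
  flatten [seq comm_word (ord_even i) (ord_odd i) | i <- enum 'I_n].

Definition is_orientable_surface_group (G : groupType) (n : nat) : Prop :=
  has_presentation G [:: commutators_word n].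

Definition is_subgroup (G : groupType) (H : set G) : Prop :=
  [/\ H 1, (forall g h, H g -> H h -> H (g * h)) & (forall g, H g -> H g^-1)].

(* A retraction G -> H is encoded as an endomorphism of G with values in H. *)
Definition is_retract (G : groupType) (H : set G) : Prop :=
  is_subgroup H /\
  exists r : {multiplicative G -> G},
    (forall g, H (r g)) /\ (forall g, H g -> r g = g).

Definition proper_retracts (G : groupType) : set (set G) :=
  [set H | is_retract H /\ H <> setT].
Arguments proper_retracts G : clear implicits.

Definition union_proper_retracts (G : groupType) : set G :=
  \bigcup_(H in proper_retracts G) H.
Arguments union_proper_retracts G : clear implicits.

Definition is_product_of (G : groupType) (X : {fset G}) (k : nat) (g : G) : Prop :=
  exists s : seq G,
    [/\ size s = k, all (fun y => (y \in X) || (y^-1 \in X)) s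
      & g = \prod_(y <- s) y].

Definition generates (G : groupType) (X : {fset G}) : Prop :=
  forall g : G, exists k : nat, is_product_of X k g.

(* |g|_X = k, as a relation, since |g|_X is undefined for g outside <X>. *)
Definition is_word_length (G : groupType) (X : {fset G}) (g : G) (k : nat) : Prop :=
  is_product_of X k g /\ forall j : nat, is_product_of X j g -> k <= j.

Definition word_ball (G : groupType) (X : {fset G}) (r : nat) : set G :=
  [set g | exists2 k : nat, is_word_length X g k & k <= r].

(* Only meant for finite S ([fset_set] returns the empty set otherwise);
   balls are finite because X is. *)
Definition nb_elts (G : groupType) (S : set G) : nat := #|` fset_set S |.

(* The limsup is taken in the extended reals. *)
Definition asymptotic_density (R : realType) (G : groupType) (X : {fset G}) (S : set G) : \bar R :=
  limn_esup (fun k : nat =>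
    ((nb_elts (S `&` word_ball X k))%:R / (nb_elts (word_ball X k))%:R : R)%R%:E).

(* Main.v *)
(* Mod 2, the abelianization and the second layer of the Magnus expansion turn
   an endomorphism r into a matrix E over F_2 acting on row vectors (magnus1) and
   by congruence S |-> E^T S E on matrices (magnus2, modulo magnus2 of the relator).
   Let r be a retraction onto a proper subgroup R.
   - Surface groups: in the Schreier graph of R, the relator read through r is a
     cycle made of d copies of the relator; by Poincare duality the multiplicities
     are constant, so if d is odd R has finite odd index, and comparing the first
     homology of R (Euler characteristic) with that of G forces R = G.  Hence d is
     even and E^T J E = 0, where J is the degree-two part of the relator.
     Non-orientable case: J = 1, so (1, ..., 1) E = 0 and no element of class
     (1, ..., 1) is fixed by r.  Orientable case: rank E <= n, so an element of
     class (0, S) with rank S, rank (S + J) > n is not fixed by r.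
   - Free groups: an element of class (0, S) with S invertible forces E = 1, and
     then r = id because free groups are residually 2-groups; the latter is seen
     on a ping-pong representation by integer matrices congruent to 1 modulo 2.
   Every element can be moved into such a class by right multiplication by one of
   few short words in X, so the complement of the union of the proper retracts has
   positive lower density. *)

Require Import Defs.
From mathcomp Require Import all_boot all_order all_algebra finmap.
From mathcomp Require Import all_classical all_reals all_analysis.
From mathcomp Require Import zify ring.

Set Implicit Arguments.
Unset Strict Implicit.
Unset Printing Implicit Defensive.

Import Order.TTheory GRing.Theory Num.Theory.

Local Open Scope group_scope.

(** * Words and the Magnus expansion modulo 2 *)

Definition flip_letter (m : nat) (l : 'I_m * bool) : 'I_m * bool := (l.1, ~~ l.2).

Definition word_inv (m : nat) (w : word m) : word m := rev (map (@flip_letter m) w).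

Definition subst_letter (m k : nat) (W : 'I_m -> word k) (l : 'I_m * bool) : word k :=
  if l.2 then word_inv (W l.1) else W l.1.

Definition subst_word (m k : nat) (W : 'I_m -> word k) (w : word m) : word k :=
  flatten [seq subst_letter W l | l <- w].

Lemma subst_word_cons m k (W : 'I_m -> word k) l w :
  subst_word W (l :: w) = subst_letter W l ++ subst_word W w.
Proof. by []. Qed.

Lemma word_inv_cons m (l : 'I_m * bool) w :
  word_inv (l :: w) = word_inv w ++ [:: flip_letter l].
Proof. by rewrite /word_inv /= rev_cons cats1. Qed.

Section Evaluation.
Variables (G : groupType) (m : nat) (x : 'I_m -> G).

Lemma eval_word_nil : eval_word x [::] = 1.
Proof. by rewrite /eval_word big_nil. Qed.

Lemma eval_word_cons l w : eval_word x (l :: w) = eval_letter x l * eval_word x w.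
Proof. by rewrite /eval_word big_cons. Qed.

Lemma eval_word_cat w1 w2 : eval_word x (w1 ++ w2) = eval_word x w1 * eval_word x w2.
Proof. by rewrite /eval_word big_cat. Qed.

Lemma eval_word1 l : eval_word x [:: l] = eval_letter x l.
Proof. by rewrite eval_word_cons eval_word_nil mulg1. Qed.

Lemma eval_flip l : eval_letter x (flip_letter l) = (eval_letter x l)^-1.
Proof. by case: l => i [] /=; rewrite /eval_letter /= ?invgK. Qed.

Lemma eval_word_inv w : eval_word x (word_inv w) = (eval_word x w)^-1.
Proof.
elim: w => [|l w IHw]; first by rewrite !eval_word_nil invg1.
by rewrite word_inv_cons eval_word_cat IHw eval_word1 eval_flip eval_word_cons invgM.
Qed.

End Evaluation.

Lemma eval_subst_word (G : groupType) m (x : 'I_m -> G) k (W : 'I_k -> word m) w :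
  eval_word x (subst_word W w) = eval_word (fun i => eval_word x (W i)) w.
Proof.
elim: w => [|l w IHw]; first by rewrite -[subst_word _ _]/[::] !eval_word_nil.
rewrite subst_word_cons eval_word_cat IHw eval_word_cons; congr (_ * _).
by case: l => i []; rewrite /subst_letter /eval_letter /= ?eval_word_inv.
Qed.

Lemma multiplicative1 (G : groupType) (r : {multiplicative G -> G}) : r 1 = 1.
Proof. by apply: (mulgI (r 1)); rewrite -gmulfM !mulg1. Qed.

Lemma multiplicativeV (G : groupType) (r : {multiplicative G -> G}) g : r g^-1 = (r g)^-1.
Proof. by apply: (mulgI (r g)); rewrite -gmulfM !mulgV multiplicative1. Qed.

Lemma gmulf_eval_word (G : groupType) m (x : 'I_m -> G) (r : {multiplicative G -> G}) w :
  r (eval_word x w) = eval_word (r \o x) w.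
Proof.
elim: w => [|l w IHw]; first by rewrite !eval_word_nil multiplicative1.
rewrite !eval_word_cons gmulfM IHw; congr (_ * _).
by case: l => i []; rewrite /eval_letter /= ?multiplicativeV.
Qed.

Lemma eq_eval_word (G : groupType) (m : nat) (x y : 'I_m -> G) w :
  x =1 y -> eval_word x w = eval_word y w.
Proof. by move=> xy; apply: eq_bigr => l _; rewrite /eval_letter xy. Qed.

Lemma pres_eq_cons m rels (l : 'I_m * bool) w1 w2 :
  pres_eq rels w1 w2 -> pres_eq rels (l :: w1) (l :: w2).
Proof.
by move=> h; have := pres_cat [:: l] [::] h; rewrite !cats0.
Qed.

Section Magnus.
Local Open Scope ring_scope.
Variable m : nat.
Implicit Types (w u : word m) (l : 'I_m * bool).

(* [(magnus1 w, magnus2 w)] are the terms of degree one and two of the Magnus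
   expansion [x_i |-> 1 + X_i] of [w] over F_2; the monomial [X_i X_j] is
   recorded in the entry [(i, j)]. *)
Definition magnus1 w : 'rV['F_2]_m := \sum_(l <- w) delta_mx 0 l.1.

Fixpoint magnus2 w : 'M['F_2]_m :=
  if w is l :: w' then
    (if l.2 then delta_mx l.1 l.1 else 0) + magnus2 w'
    + (delta_mx 0 l.1)^T *m magnus1 w'
  else 0.

Lemma addF2 (a : 'F_2) : a + a = 0.
Proof. by apply/val_inj; case: a => [[|[|]]]. Qed.

Lemma addFF2 (V : lmodType 'F_2) (v : V) : v + v = 0.
Proof. by rewrite -[v]scale1r -scalerDl addF2 scale0r. Qed.

Lemma opprF2 (V : lmodType 'F_2) (v : V) : - v = v.
Proof. by apply/eqP; rewrite eq_sym -subr_eq0 opprK addFF2. Qed.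

Lemma magnus1_nil : magnus1 [::] = 0.
Proof. by rewrite /magnus1 big_nil. Qed.

Lemma magnus1_cons l w : magnus1 (l :: w) = delta_mx 0 l.1 + magnus1 w.
Proof. by rewrite /magnus1 big_cons. Qed.

Lemma magnus1_cat w u : magnus1 (w ++ u) = magnus1 w + magnus1 u.
Proof. by rewrite /magnus1 big_cat. Qed.

Lemma magnus2_cat w u :
  magnus2 (w ++ u) = magnus2 w + magnus2 u + (magnus1 w)^T *m magnus1 u.
Proof.
elim: w => [|l w IHw] /=; first by rewrite magnus1_nil trmx0 mul0mx add0r addr0.
rewrite IHw magnus1_cat magnus1_cons mulmxDr [(_ + _)^T]linearD /= [in RHS]mulmxDl.
set A := magnus2 u; set B := _ *m magnus1 w; set C := _ *m _; set D := _ *m _.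
by apply/matrixP => i j; rewrite !mxE; ring.
Qed.

Lemma magnus1_inv w : magnus1 (word_inv w) = magnus1 w.
Proof.
elim: w => [|l w IHw] //.
by rewrite word_inv_cons magnus1_cat IHw !magnus1_cons magnus1_nil addr0 addrC.
Qed.

(** Since [(1 + X)^-1 = 1 + X + X^2 + ...] over F_2, inverting a letter only adds a diagonal entry
    in degree two. *)
Lemma magnus2_letter l : magnus2 [:: l] = if l.2 then delta_mx l.1 l.1 else 0.
Proof. by rewrite /= magnus1_nil mulmx0 !addr0. Qed.

Lemma trmx_delta_mul (i j : 'I_m) :
  (delta_mx 0 i : 'rV['F_2]_m)^T *m delta_mx 0 j = delta_mx i j.
Proof. by rewrite trmx_delta mul_delta_mx. Qed.

Lemma magnus2_cancel l : magnus2 [:: l; flip_letter l] = 0.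
Proof.
rewrite -cat1s magnus2_cat !magnus2_letter !magnus1_cons !magnus1_nil !addr0.
by rewrite trmx_delta_mul; case: l => i [] /=; rewrite ?addr0 ?add0r addFF2.
Qed.

(** Over F_2 only the parity of the number of occurrences matters; such sums vanish on a relator of
    zero [magnus1]. *)
Lemma sum_letters (V : lmodType 'F_2) (F : 'I_m -> V) w :
  \sum_(l <- w) F l.1 = \sum_i magnus1 w 0 i *: F i.
Proof.
elim: w => [|l w IHw].
  by rewrite big_nil magnus1_nil big1 // => i _; rewrite mxE scale0r.
rewrite big_cons IHw magnus1_cons.
under [RHS]eq_bigr => i _ do rewrite mxE scalerDl.
rewrite big_split; congr (_ + _).
rewrite (bigD1 l.1) //= mxE !eqxx scale1r big1 ?addr0 // => i il.
by rewrite mxE (negbTE il) scale0r.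
Qed.

Lemma magnus1_pres_eq rels w u :
  (forall r, r \in rels -> magnus1 r = 0) -> pres_eq rels w u -> magnus1 w = magnus1 u.
Proof.
move=> rels0; elim=> // {w u} [w1 w2 w3 _ -> _ -> //|a b w1 w2 _ h|i b|r /rels0 ->].
- by rewrite !magnus1_cat h.
- by rewrite !magnus1_cons magnus1_nil addr0 addFF2.
- by rewrite magnus1_nil.
Qed.

Lemma magnus2_free_eq w u : pres_eq [::] w u -> magnus2 w = magnus2 u.
Proof.
elim=> // {w u} [w1 w2 w3 _ -> _ -> //|a b w1 w2 e h|i b].
- by rewrite !magnus2_cat h !magnus1_cat (magnus1_pres_eq _ e).
- exact: (magnus2_cancel (i, b)).
Qed.

Lemma cat_word_inv_free w : pres_eq [::] (w ++ word_inv w) [::].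
Proof.
elim: w => [|l w IHw]; first exact: pres_refl.
rewrite word_inv_cons; apply: (pres_trans (w2 := [:: l] ++ [::] ++ [:: flip_letter l])).
  rewrite (_ : (l :: w) ++ _ = [:: l] ++ (w ++ word_inv w) ++ [:: flip_letter l]).
    exact: pres_cat.
  by rewrite /= catA.
by case: l => i b; apply: pres_cancel.
Qed.

Lemma magnus2_inv w : magnus2 (word_inv w) = magnus2 w + (magnus1 w)^T *m magnus1 w.
Proof.
have := magnus2_free_eq (cat_word_inv_free w).
rewrite magnus2_cat magnus1_inv /= => /eqP.
by rewrite addr_eq0 opprF2 => /eqP <-; rewrite addrA addFF2 add0r.
Qed.

(** The shuffle relation: for distinct [i], [j], the coefficients of [X_i X_j] and [X_j X_i] add up
    to the product of those of [X_i] and [X_j]; on the diagonal both sides vanish. So [magnus2 w] is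
    symmetric once [magnus1 w] is zero. *)
Lemma magnus2_sym w :
  magnus2 w + (magnus2 w)^T
  = (magnus1 w)^T *m magnus1 w + diag_mx (magnus1 w).
Proof.
elim: w => [|l w IHw].
  by rewrite magnus1_nil trmx0 mulmx0 linear0 !addr0.
have dl : diag_mx (magnus1 [:: l]) = delta_mx l.1 l.1.
  rewrite magnus1_cons magnus1_nil addr0; apply/matrixP => i j; rewrite !mxE.
  case: (eqVneq i j) => [->|ij]; first by rewrite mulr1n andbb.
  by rewrite mulr0n; case: eqP => [<-|]; rewrite // (eq_sym j) (negbTE ij).
have sl : magnus2 [:: l] + (magnus2 [:: l])^T = 0.
  by rewrite magnus2_letter; case: l.2; rewrite ?trmx0 ?trmx_delta addFF2.
have vl : (magnus1 [:: l])^T *m magnus1 [:: l] = delta_mx l.1 l.1.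
  by rewrite magnus1_cons magnus1_nil addr0 trmx_delta_mul.
have tD n p (A B : 'M['F_2]_(n, p)) : (A + B)^T = A^T + B^T by exact: linearD.
rewrite -[l :: w]cat1s magnus2_cat magnus1_cat [diag_mx (_ + _)]linearD.
rewrite [X in _ = _ + X](_ : _ = delta_mx l.1 l.1 + diag_mx (magnus1 w)); last by rewrite -dl.
move: (magnus1 [:: l]) (magnus2 [:: l]) (magnus1 w) (magnus2 w) sl vl IHw
  (addFF2 (delta_mx l.1 l.1 : 'M['F_2]_m)).
move=> v1 s1 v s sl vl IHw gg; rewrite !tD trmx_mul trmxK mulmxDl !mulmxDr vl.
move: (delta_mx _ _) (v1^T *m v) (v^T *m v1) (v^T *m v) (diag_mx v) IHw gg => g a b c f IHw gg.
suff: (s1 + s1^T) + (s + s^T) + (a + b) = (g + g) + (c + f) + (a + b).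
  move/matrixP => h; apply/matrixP => i j; have := h i j; rewrite !mxE => h'.
  by apply: etrans (etrans _ h') _; ring.
by rewrite sl IHw gg.
Qed.

End Magnus.

Section MagnusSubst.
Local Open Scope ring_scope.
Variables (m k : nat) (W : 'I_m -> word k).

Definition word_mx : 'M['F_2]_(m, k) := \matrix_i magnus1 (W i).

Lemma delta_word_mx i : delta_mx 0 i *m word_mx = magnus1 (W i).
Proof. by rewrite -rowE rowK. Qed.

Lemma magnus1_subst w : magnus1 (subst_word W w) = magnus1 w *m word_mx.
Proof.
elim: w => [|l w IHw]; first by rewrite !magnus1_nil mul0mx.
rewrite subst_word_cons magnus1_cat IHw magnus1_cons mulmxDl delta_word_mx.
by rewrite /subst_letter; case: l.2; rewrite ?magnus1_inv.
Qed.

(** Each [X_i] is replaced by a linear form (row [i] of [word_mx]) plus the quadratic term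
    [magnus2 (W i)]: the linear forms act by congruence, the quadratic terms enter once per
    letter. *)
Lemma magnus2_subst w :
  magnus2 (subst_word W w)
  = word_mx^T *m magnus2 w *m word_mx + \sum_(l <- w) magnus2 (W l.1).
Proof.
elim: w => [|l w IHw]; first by rewrite big_nil /= mulmx0 mul0mx addr0.
rewrite subst_word_cons magnus2_cat IHw magnus1_subst big_cons /=.
rewrite !mulmxDr !mulmxDl.
have -> : magnus1 (subst_letter W l) = magnus1 (W l.1).
  by rewrite /subst_letter; case: l.2; rewrite ?magnus1_inv.
have -> : magnus2 (subst_letter W l) = magnus2 (W l.1) +
   word_mx^T *m (if l.2 then delta_mx l.1 l.1 else 0) *m word_mx.
  rewrite /subst_letter; case: l.2; last by rewrite mulmx0 mul0mx addr0.
  rewrite magnus2_inv; congr (_ + _); rewrite -trmx_delta_mul.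
  by rewrite -!mulmxA delta_word_mx mulmxA -trmx_mul delta_word_mx.
rewrite -(delta_word_mx l.1) trmx_mul !mulmxA.
set a := magnus2 _; set b := _ *m word_mx; set c := _ *m word_mx.
set d := _ *m word_mx; set e := \sum_(_ <- _) _.
by apply/matrixP => i j; rewrite !mxE; ring.
Qed.

End MagnusSubst.

Lemma magnus2_subst0 m k (W : 'I_m -> word k) w : magnus1 w = 0%R ->
  magnus2 (subst_word W w) = ((word_mx W)^T *m magnus2 w *m word_mx W)%R.
Proof.
move=> w0; rewrite magnus2_subst (sum_letters (fun i => magnus2 (W i))) w0 big1 ?addr0 // => i _.
by rewrite mxE scale0r.
Qed.

(** * Retracts of surface groups *)

Section SchreierGraph.
Variables (G : groupType) (m : nat) (x : 'I_m -> G) (r : {multiplicative G -> G}).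
Implicit Types (g h k : G) (w u : word m) (i j : 'I_m).

(* When [r] is a retraction onto [R], the map [g |-> act 1 g] identifies the
   right cosets of [R] with the kernel of [r], and [act] is the right
   multiplication action on cosets. *)
Definition act k g : G := (r g)^-1 * k * g.

Lemma actM k g h : act k (g * h) = act (act k g) h.
Proof. by rewrite /act gmulfM invgM !mulgA. Qed.

Lemma act1 k : act k 1 = k.
Proof. by rewrite /act multiplicative1 invg1 mul1g mulg1. Qed.

Lemma actK k g : act (act k g) g^-1 = k.
Proof. by rewrite -actM mulgV act1. Qed.

Lemma actKV k g : act (act k g^-1) g = k.
Proof. by rewrite -actM mulVg act1. Qed.

Lemma eq_actV h k g : (h == act k g^-1) = (k == act h g).
Proof. by apply/eqP/eqP => ->; rewrite ?actK ?actKV. Qed.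

(* [chain k w h j] counts modulo 2 how often the path starting at [k] and
   labelled by [w] runs through the edge [h -> act h (x j)]. *)
Fixpoint chain k w h j : 'F_2 :=
  if w is l :: w' then
    (((h == if l.2 then act k (x l.1)^-1 else k) && (j == l.1))%:R
    + chain (act k (eval_letter x l)) w' h j)%R
  else 0%R.

Lemma chain_cat k w u h j :
  chain k (w ++ u) h j = (chain k w h j + chain (act k (eval_word x w)) u h j)%R.
Proof.
elim: w k => [|l w IHw] k; first by rewrite eval_word_nil act1 /= add0r.
by rewrite /= IHw eval_word_cons actM addrA.
Qed.

Lemma chain_inv k w h j :
  chain (act k (eval_word x w)) (word_inv w) h j = chain k w h j.
Proof.
elim: w k => [|l w IHw] k //.
rewrite word_inv_cons chain_cat eval_word_cons actM IHw eval_word_inv actK.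
rewrite /= addr0 addrC; congr ((_%:R + _)%R).
by case: l => i [] //=; rewrite /eval_letter /= actK.
Qed.

(** Coefficient at the edge [(h, j)] of the paths labelled [w], the one starting at [k] being
    weighted by [f k]; the form dual to [chain], which avoids a sum over [G]. *)
Fixpoint coef (f : G -> 'F_2) w h j : 'F_2 :=
  if w is l :: w' then
    ((j == l.1)%:R * f (if l.2 then act h (x l.1) else h)
    + coef (fun k => f (act k (eval_letter x l)^-1)) w' h j)%R
  else 0%R.

Lemma coef_cat f w u h j :
  coef f (w ++ u) h j
  = (coef f w h j + coef (fun k => f (act k (eval_word x w)^-1)) u h j)%R.
Proof.
elim: w f => [|l w IHw] f.
  by rewrite /= add0r; congr coef; apply/funext => k; rewrite eval_word_nil invg1 act1.
rewrite /= IHw addrA; congr (_ + coef _ _ _ _)%R; apply/funext => k.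
by rewrite eval_word_cons invgM actM.
Qed.

Lemma coef_notin f w h j : (forall l, l \in w -> l.1 != j) -> coef f w h j = 0%R.
Proof.
elim: w f => [|l w IHw] f //= nj.
rewrite eq_sym (negbTE (nj l _)) ?mem_head // mul0r add0r IHw // => l' l'w.
by rewrite nj // in_cons l'w orbT.
Qed.

Definition mult (D : seq G) h : 'F_2 := (\sum_(d <- D) (d == h)%:R)%R.

Lemma sum_chain (D : seq G) w h j :
  (\sum_(d <- D) chain d w h j)%R = coef (mult D) w h j.
Proof.
elim: w D => [|l w IHw] D /=; first by rewrite big1.
rewrite big_split /=; congr (_ + _)%R.
  rewrite /mult mulr_sumr; apply: eq_bigr => d _.
  rewrite -natrM mulnb andbC; congr ((_ && _)%:R)%R.
  by case: l.2; rewrite ?eq_actV // eq_sym.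
have := IHw [seq act d (eval_letter x l) | d <- D].
rewrite big_map => ->; congr coef; apply/funext => k.
rewrite /mult big_map; apply: eq_bigr => d _; congr ((nat_of_bool _)%:R)%R.
by rewrite eq_actV eq_sym.
Qed.

End SchreierGraph.

(* Poincare duality for the relator: the only 2-cycles with coefficients in
   the functions on a coset space are the constants. *)
Definition dual_relator (G : groupType) (m : nat) (x : 'I_m -> G) (rel : word m) : Prop :=
  forall (r : {multiplicative G -> G}) (f : G -> 'F_2),
    (forall h j, coef x r f rel h j = 0%R) -> forall h j, f (act r h (x j)) = f h.

Lemma natF2 n : (n%:R = (odd n)%:R :> 'F_2)%R.
Proof.
rewrite -[n in LHS]odd_double_half natrD -muln2 natrM.
by rewrite (_ : 2%:R = 0 :> 'F_2)%R ?mulr0 ?addr0 //; apply/val_inj.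
Qed.

Lemma F2_cases (a : 'F_2) : a = 0%R \/ a = 1%R.
Proof. by case: a => [[|[|]]] // ?; [left|right]; apply/val_inj. Qed.

Lemma multE (T : eqType) (D : seq T) h :
  (\sum_(d <- D) (d == h)%:R)%R = (count_mem h D)%:R%R :> 'F_2.
Proof.
elim: D => [|d D IHD]; first by rewrite big_nil.
by rewrite big_cons IHD /= natrD.
Qed.

Lemma sum_undup (T : eqType) (D : seq T) :
  (\sum_(h <- undup D) (count_mem h D)%:R)%R = (size D)%:R%R :> 'F_2.
Proof.
under eq_bigr => h _ do rewrite -multE.
rewrite exchange_big /= -sum1_size natr_sum.
rewrite [LHS]big_seq [RHS]big_seq; apply: eq_bigr => d dD.
rewrite (bigD1_seq d) /= ?mem_undup ?undup_uniq // eqxx big1 ?addr0 // => h hd.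
by rewrite eq_sym (negbTE hd).
Qed.

(** * Retractions of one-relator groups whose relator satisfies duality *)

Section SurfaceRetract.
Variables (G : groupType) (m : nat) (x : 'I_m -> G) (rel : word m).
Hypothesis pres : presented_by [:: rel] x.
Hypothesis rel0 : magnus1 rel = 0%R.
Variable r : {multiplicative G -> G}.

Lemma eval_pres_eq w u : pres_eq [:: rel] w u -> eval_word x w = eval_word x u.
Proof. by move/(pres.2 w u). Qed.

(** [gs] lists the conjugators of the relators consumed in a derivation of [w = u]. Each adds a
    translated relator loop to the chain and, as [magnus1 rel = 0], one copy of [magnus2 rel]; the
    common list ties the Schreier graph to the Magnus expansion. *)
Lemma pres_eq_chain w u : pres_eq [:: rel] w u ->
  exists gs : seq G,
    (forall k h j, chain x r k w h j
       = chain x r k u h j + \sum_(g <- gs) chain x r (act r k g) rel h j)%R /\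
    magnus2 w = (magnus2 u + (size gs)%:R *: magnus2 rel)%R.
Proof.
have rel0' : forall s, s \in [:: rel] -> magnus1 s = 0%R by move=> s; rewrite inE => /eqP ->.
elim=> {w u} [w|w u _ [gs [ch mg]]|w1 w2 w3 _ [gs [ch mg]] _ [gs' [ch' mg']]
  |a b w u e [gs [ch mg]]|i b|w].
- exists [::]; split=> [k h j|]; first by rewrite big_nil addr0.
  by rewrite scale0r addr0.
- exists gs; split=> [k h j|]; first by rewrite ch -addrA addF2 addr0.
  by rewrite mg -addrA addFF2 addr0.
- exists (gs' ++ gs); split=> [k h j|]; first by rewrite ch ch' big_cat addrA.
  by rewrite mg mg' size_cat natrD scalerDl addrA.
- exists [seq eval_word x a * g | g <- gs]; split=> [k h j|].
    rewrite !chain_cat ch (eval_pres_eq e) big_map.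
    under [in RHS]eq_bigr => g _ do rewrite actM.
    ring.
  rewrite !magnus2_cat mg !magnus1_cat (magnus1_pres_eq rel0' e) size_map.
  move: (_ *: _)%R (_ *m _)%R (_ *m _)%R => A B C.
  move: (magnus2 _) (magnus2 _) (magnus2 _) => D E F.
  by apply/matrixP => i j; rewrite !mxE; ring.
- exists [::]; split=> [k h j|].
    rewrite /= big_nil !addr0.
    by case: b; rewrite /= /eval_letter /= ?actK addF2.
  by rewrite scale0r addr0; exact: (magnus2_cancel (i, b)).
- rewrite inE => /eqP ->; exists [:: 1]; split=> [k h j|].
    by rewrite big_seq1 act1 add0r.
  by rewrite scale1r add0r.
Qed.

Hypothesis dual : dual_relator x rel.
Hypothesis m3 : 2 < m.
Hypothesis idem : forall g, r (r g) = r g.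
Variable W : 'I_m -> word m.
Hypothesis WP : forall i, eval_word x (W i) = r (x i).

Lemma act1_retract g : act r 1 (r g) = 1.
Proof. by rewrite /act idem mulg1 mulVg. Qed.

(** Each [W i] labels a loop at the base vertex, so chains of consecutive loops add up; a loop and
    its reverse have the same chain modulo 2. *)
Lemma chain_subst w h j :
  chain x r 1 (subst_word W w) h j = (\sum_(l <- w) chain x r 1 (W l.1) h j)%R.
Proof.
have WE i : act r 1 (eval_word x (W i)) = 1 by rewrite WP act1_retract.
elim: w => [|l w IHw]; first by rewrite big_nil.
rewrite subst_word_cons chain_cat big_cons /subst_letter; case: l => i b /=.
case: b => /=; last by rewrite WE IHw.
have WVE : act r 1 (eval_word x (W i))^-1 = 1 by rewrite -{1}(WE i) actK.
rewrite eval_word_inv WVE IHw; congr (_ + _)%R.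
by rewrite -[in RHS](chain_inv x r 1) WE.
Qed.

(** The translated relator loops form a 2-cycle, so [dual] gives invariance under each generator,
    hence under [G]. *)
Lemma multiplicities_invariant (gs : seq G) :
  (forall h j, \sum_(g <- gs) chain x r (act r 1 g) rel h j = 0)%R ->
  forall k g, mult (map (act r 1) gs) (act r k g) = mult (map (act r 1) gs) k.
Proof.
move=> cyc k g; set f := mult _.
have inv1 h j : f (act r h (x j)) = f h.
  apply: dual => h' j'; rewrite -sum_chain big_map; exact: cyc.
have [w <-] := pres.1 g; elim: w k => [|l w IHw] k; first by rewrite eval_word_nil act1.
rewrite eval_word_cons actM IHw; case: l => i b; rewrite /eval_letter /=.
case: b; last exact: inv1.
by rewrite -[k in RHS](actKV r k (x i)) inv1.
Qed.

(* The first homology of the cover with vertex set [V] has rank at least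
   [size V * (m - 2) + 1] by the Euler characteristic, and at most [m] since
   its fundamental group is a quotient of [G]. *)
Lemma cover_size (V : seq G) :
  uniq V -> {in V, forall h, r h = 1} -> (forall g, act r 1 g \in V) ->
  size V * m <= size V + m + (size V - 1).
Proof.
move=> uV rV VP; have V1 : 1 \in V by rewrite -(act1 r 1) VP.
set p := size V.
pose vtx (a : 'I_p) : G := nth 1 V a.
pose mx (F : G -> 'I_m -> 'F_2) : 'M['F_2]_(p, m) := (\matrix_(a, j) F (vtx a) j)%R.
have /boolp.choice [word_of word_ofP] : forall g, exists w, eval_word x w = g := pres.1.
(* The empty word at 1 has zero chain, which leaves only [size V - 1] paths to count. *)
pose U g := if g == 1 then [::] else word_of g.
have UP g : eval_word x (U g) = g.
  by rewrite /U; case: eqP => [->|]; rewrite ?eval_word_nil.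
(* A spanning family of the edge chains: relator loops at the vertices, the loops [W i], and paths
   from the base vertex to the other vertices. *)
pose S := [seq mx (chain x r h rel) | h <- V] ++
  [seq mx (chain x r 1 (W i)) | i <- enum 'I_m] ++
  [seq mx (chain x r 1 (U h)) | h <- rem 1 V].
suff fullS : (fullv <= <<S>>)%VS.
  have := dimvS fullS; rewrite dimvf dim_matrix => /leq_trans -> //.
  apply: leq_trans (dim_span S) _.
  by rewrite /S !size_cat !size_map -enumT size_enum_ord size_rem // -/p subn1 addnA.
have relS h : h \in V -> mx (chain x r h rel) \in <<S>>%VS.
  move=> hV; apply: memv_span; rewrite mem_cat.
  by apply/orP; left; apply/mapP; exists h.
have WS i : mx (chain x r 1 (W i)) \in <<S>>%VS.
  apply: memv_span; rewrite !mem_cat.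
  by apply/or3P; apply: Or32; apply/mapP; exists i; rewrite ?mem_enum.
have US h : h \in V -> mx (chain x r 1 (U h)) \in <<S>>%VS.
  move=> hV; have [h1|h1] := eqVneq h 1.
    rewrite (_ : mx _ = 0)%R ?mem0v //.
    by apply/matrixP => a j; rewrite !mxE /U h1 eqxx.
  apply: memv_span; rewrite !mem_cat; apply/or3P; apply: Or33.
  by apply/mapP; exists h => //; rewrite mem_rem_uniq // !inE h1.
apply/subvP => M _; rewrite (matrix_sum_delta M).
apply: memv_suml => a _; apply: memv_suml => j _; apply: memvZ.
set k := vtx a; have kV : k \in V by apply: mem_nth; rewrite ltn_ord.
pose k' := act r k (x j).
have actk : act r 1 k = k by rewrite /act rV // invg1 !mul1g.
have k'V : k' \in V by rewrite /k' -actk -actM.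
(* Since [k * x_j = r (x_j) * k'], both words have the same value and their chains differ by relator
   loops; this isolates the edge from [k] to [k']. *)
have [|gs [ch _]] := @pres_eq_chain (U k ++ [:: (j, false)]) (W j ++ U k').
  apply/pres.2; rewrite !eval_word_cat !UP WP eval_word1 /eval_letter /= /k' /act.
  by rewrite !mulgA mulgV mul1g.
have -> : delta_mx a j = (mx (chain x r 1 (U k)) + mx (chain x r 1 (W j)) +
    mx (chain x r 1 (U k')) + \sum_(g <- gs) mx (chain x r (act r 1 g) rel))%R.
  apply/matrixP => b i; rewrite !mxE summxE.
  have := ch 1 (vtx b) i; rewrite !chain_cat UP WP act1_retract actk /= addr0.
  under [in X in _ -> X]eq_bigr => g _ do rewrite mxE.
  rewrite {2}/k (nth_uniq 1 (ltn_ord b) (ltn_ord a) uV).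
  move: (\sum_(_ <- _) _)%R => S0; rewrite -/k => h.
  apply: (addrI (chain x r 1 (U k) (vtx b) i)).
  by rewrite h !addrA addF2 add0r.
rewrite !memvD ?WS ?US //.
by apply: memv_suml => g _; apply: relS.
Qed.

Theorem surface_retract :
  (forall g, r g = g) \/ ((word_mx W)^T *m magnus2 rel *m word_mx W = 0)%R.
Proof.
(* The relator read through [r] is trivial in [G]; the parity of the number of relators it consumes
   decides between the two alternatives. *)
have [|gs [ch mg]] := @pres_eq_chain (subst_word W rel) [::].
  apply/pres.2; rewrite eval_subst_word (eq_eval_word rel WP).
  rewrite -(gmulf_eval_word x r) eval_word_nil (_ : eval_word x rel = 1) ?multiplicative1 //.
  by rewrite -(eval_word_nil x); apply: eval_pres_eq; apply: pres_rel; rewrite inE.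
move: mg; rewrite magnus2_subst0 //= add0r natF2 => mg.
have [odd_gs|] := boolP (odd (size gs)); last by move/negbTE=> ev; right; rewrite mg ev scale0r.
left; pose D := map (act r 1) gs.
have inv := @multiplicities_invariant gs _.
have {inv} inv k g : mult D (act r k g) = mult D k.
  apply: inv => h j.
  (* Every generator occurs an even number of times in [rel], so the chain of the substituted
     relator is zero. *)
  have := ch 1 h j; rewrite chain_subst /= add0r => <-.
  rewrite (sum_letters (V := ('F_2)^o) (fun i => chain x r 1 (W i) h j)) rel0.
  by rewrite big1 // => i _; rewrite mxE scale0r.
have Dmult h : h \in D -> mult D h = mult D 1 by case/mapP => g _ ->.
(* The constant multiplicity, summed over the distinct vertices, gives the odd number [size D];
   hence it is 1 and the number of vertices is odd. *)
have sumD : (\sum_(h <- undup D) mult D 1)%R = 1%R :> 'F_2.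
  have -> : 1%R = (size D)%:R%R :> 'F_2 by rewrite natF2 size_map odd_gs.
  rewrite -sum_undup.
  rewrite [LHS]big_seq [RHS]big_seq; apply: eq_bigr => h.
  by rewrite mem_undup -multE => /Dmult <-.
have D1 : mult D 1 = 1%R.
  have [D0|//] := F2_cases (mult D 1).
  by move: sumD; rewrite D0 big1 // => /eqP; rewrite eq_sym oner_eq0.
set V := undup D in sumD.
have VP g : act r 1 g \in V.
  rewrite mem_undup -has_pred1 has_count lt0n; apply/eqP => c0.
  by have := oner_neq0 'F_2; rewrite -D1 -(inv 1 g) /mult multE c0 eqxx.
have rV : {in V, forall h, r h = 1}.
  move=> h; rewrite mem_undup => /mapP[g _ ->].
  by rewrite /act mulg1 gmulfM multiplicativeV idem mulVg.
have := cover_size (undup_uniq D) rV VP; rewrite -/V.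
have oddV : odd (size V).
  by move: sumD; rewrite D1 -(natr_sum _ _ _ (fun=> 1%N)) sum1_size natF2;
    case: (odd (size V)) => //.
(* A single vertex means [act r 1 g = 1], that is [r g = g]. *)
have V1 : size V <= 1 -> forall g, r g = g.
  case EV : V VP => [|v [|]] // VP _ g; move: (VP 1) (VP g); rewrite ?in_nil //.
  rewrite !inE act1 => /eqP <- /eqP.
  by rewrite /act mulg1 => /(congr1 (fun z => r g * z)); rewrite mulVKg mulg1.
(* For [p] vertices the bound reads [(p - 1) * (m - 2) <= 1], so [p] odd and [m >= 3] leave only
   [p = 1]. *)
move=> le; apply: V1; move: oddV le m3; move: (size V) => p; clear.
by case: p => [|[|[|p]]] // _; rewrite -ltnS; nia.
Qed.

End SurfaceRetract.

(** * Duality for the two surface relators *)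

Lemma addF2_eq0 (a b : 'F_2) : (a + b = 0)%R -> a = b.
Proof. by move/eqP; rewrite addr_eq0 => /eqP ->; rewrite (opprF2 (b : ('F_2)^o)). Qed.

Lemma dual_squares (G : groupType) n (x : 'I_n -> G) : dual_relator x (squares_word n).
Proof.
move=> r f; rewrite /squares_word.
suff dual s : uniq s -> forall f : G -> 'F_2,
    (forall h j, j \in s ->
       coef x r f (flatten [seq [:: (i, false); (i, false)] | i <- s]) h j = 0%R) ->
    forall h j, j \in s -> f (act r h (x j)) = f h.
  by move=> f0 h j; apply: (dual (enum 'I_n)); rewrite ?enum_uniq ?mem_enum.
elim: s {f} => [|i s IHs] // /andP[iNs us] f f0.
have fi h : f (act r h (x i)) = f h.
  have := f0 (act r h (x i)) i; rewrite mem_head => /(_ isT).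
  rewrite -[X in coef _ _ _ X]/([:: (i, false); (i, false)] ++ _) coef_cat.
  rewrite (@coef_notin _ _ _ _ _ (flatten _)) /= ?eqxx ?mul1r ?addr0; last first.
    move=> l /flatten_mapP[i' i's]; rewrite !inE orbb => /eqP -> /=.
    by apply: contraNneq iNs => <-.
  by rewrite /eval_letter /= actK => /addF2_eq0.
have fiV h : f (act r h (x i)^-1) = f h by rewrite -fi actKV.
move=> h j; rewrite inE => /orP[/eqP -> //|js].
apply: IHs => // h' j' j's.
have := f0 h' j'; rewrite inE j's orbT => /(_ isT).
rewrite -[X in coef _ _ _ X]/([:: (i, false); (i, false)] ++ _) coef_cat /=.
rewrite (_ : (j' == i) = false) ?mul0r ?add0r; last by apply: contraNF iNs => /eqP <-.
congr (coef _ _ _ _ _ _ = _); apply/funext => k.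
by rewrite !eval_word_cons eval_word_nil mulg1 invgM actM !fiV.
Qed.

Lemma dual_commutators (G : groupType) n (x : 'I_n.*2 -> G) :
  dual_relator x (commutators_word n).
Proof.
move=> r f; rewrite /commutators_word.
have even_inj (i i' : 'I_n) : (ord_even i == ord_even i') = (i == i').
  by rewrite -!val_eqE /= -!muln2 eqn_pmul2r.
have odd_inj (i i' : 'I_n) : (ord_odd i == ord_odd i') = (i == i').
  by rewrite -!val_eqE /= eqSS -!muln2 eqn_pmul2r.
have even_odd (i i' : 'I_n) : (ord_even i == ord_odd i') = false.
  by rewrite -val_eqE /=; apply/eqP; lia.
suff dual s : uniq s -> forall f : G -> 'F_2,
    (forall h j, j \in s ->
       coef x r f (flatten [seq comm_word (ord_even i) (ord_odd i) | i <- s])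
         h (ord_even j) = 0%R /\
       coef x r f (flatten [seq comm_word (ord_even i) (ord_odd i) | i <- s])
         h (ord_odd j) = 0%R) ->
    forall h j, j \in s -> f (act r h (x (ord_even j))) = f h /\ f (act r h (x (ord_odd j))) = f h.
  move=> f0 h j; have jn : j./2 < n by have := ltn_ord j; lia.
  have [e o] := dual (enum 'I_n) (enum_uniq _) f (fun h _ _ => conj (f0 h _) (f0 h _))
    h (Ordinal jn) (mem_enum _ _).
  have [oj|ej] := boolP (odd j).
    by rewrite (_ : j = ord_odd (Ordinal jn)) //; apply/val_inj => /=; lia.
  by rewrite (_ : j = ord_even (Ordinal jn)) //; apply/val_inj => /=; lia.
elim: s {f} => [|i s IHs] // /andP[iNs us] f f0.
set a := x (ord_even i); set b := x (ord_odd i).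
set rest := flatten [seq comm_word (ord_even i) (ord_odd i) | i <- s] in IHs *.
have rest0 f' h j : j = ord_even i \/ j = ord_odd i -> coef x r f' rest h j = 0%R.
  move=> ij; apply: coef_notin => l /flatten_mapP[i' i's].
  have ii' : (i' == i) = false by apply: contraNF iNs => /eqP <-.
  by case: ij => ->; rewrite !inE => /or4P[] /eqP -> /=;
    rewrite ?even_inj ?odd_inj ?ii' ?even_odd // eq_sym even_odd.
have headE f' h j : coef x r f' (comm_word (ord_even i) (ord_odd i)) h j =
   ((j == ord_even i)%:R * (f' (act r h a) + f' (act r (act r h b) a)) +
    (j == ord_odd i)%:R * (f' (act r (act r h b) a) + f' (act r (act r (act r h a^-1) b) a)))%R.
  by rewrite /= /eval_letter /= !invgK -/a -/b; ring.
have cat_rest : flatten [seq comm_word (ord_even i) (ord_odd i) | i <- i :: s] =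
   comm_word (ord_even i) (ord_odd i) ++ rest by [].
have f_even h : f (act r h a) = f (act r (act r h b) a).
  have [e _] := f0 h i (mem_head _ _); apply: addF2_eq0.
  rewrite -{}e cat_rest coef_cat rest0; last by left.
  by rewrite headE eqxx even_odd mul1r mul0r !addr0.
have f_odd h : f (act r (act r h b) a) = f (act r (act r (act r h a^-1) b) a).
  have [_ e] := f0 h i (mem_head _ _); apply: addF2_eq0.
  rewrite -{}e cat_rest coef_cat rest0; last by right.
  by rewrite headE eqxx [ord_odd i == _]eq_sym even_odd mul1r mul0r add0r addr0.
have fa h : f (act r h a) = f h.
  by rewrite f_even f_odd -f_even actKV.
have fb h : f (act r h b) = f h by rewrite -fa -f_even fa.
have faV h : f (act r h a^-1) = f h by rewrite -fa actKV.
have fbV h : f (act r h b^-1) = f h by rewrite -fb actKV.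
move=> h j; rewrite inE => /orP[/eqP -> //|js].
apply: IHs => // h' j' j's.
have ij' : (j' == i) = false by apply: contraNF iNs => /eqP <-.
have := f0 h' j'; rewrite inE j's orbT => /(_ isT).
rewrite cat_rest !coef_cat !headE !even_inj !odd_inj !ij' even_odd [ord_odd j' == _]eq_sym even_odd.
rewrite !mul0r !add0r; congr (_ /\ _); congr (coef _ _ _ _ _ _ = _); apply/funext => k;
by rewrite /comm_word !eval_word_cons eval_word_nil /eval_letter /= -/a -/b mulg1
   !invgM !invgK !actM fa fb faV fbV.
Qed.

(** * Magnus expansion of the surface relators *)

Lemma magnus1_flatten (I : Type) m (F : I -> word m) (s : seq I) :
  magnus1 (flatten (map F s)) = (\sum_(i <- s) magnus1 (F i))%R.
Proof.
elim: s => [|i s IHs]; first by rewrite big_nil magnus1_nil.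
by rewrite big_cons -IHs -magnus1_cat.
Qed.

Lemma magnus2_flatten0 (I : Type) m (F : I -> word m) (s : seq I) :
  (forall i, magnus1 (F i) = 0%R) ->
  magnus2 (flatten (map F s)) = (\sum_(i <- s) magnus2 (F i))%R.
Proof.
move=> F0; elim: s => [|i s IHs]; first by rewrite big_nil.
by rewrite big_cons -IHs /= magnus2_cat F0 trmx0 mul0mx addr0.
Qed.

Lemma magnus1_square m (i : 'I_m) b : magnus1 [:: (i, b); (i, b)] = 0%R.
Proof. by rewrite !magnus1_cons magnus1_nil addr0 addFF2. Qed.

Lemma magnus2_square m (i : 'I_m) : magnus2 [:: (i, false); (i, false)] = delta_mx i i.
Proof.
by rewrite /= !magnus1_cons magnus1_nil mulmx0 !addr0 !add0r trmx_delta_mul.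
Qed.

Lemma magnus1_comm m (i j : 'I_m) : magnus1 (comm_word i j) = 0%R.
Proof.
rewrite !magnus1_cons magnus1_nil addr0 /=.
by rewrite addrA addrCA -!addrA addFF2 addr0 addFF2.
Qed.

Lemma magnus2_comm m (i j : 'I_m) :
  magnus2 (comm_word i j) = (delta_mx i j + delta_mx j i)%R.
Proof.
rewrite /= !magnus1_cons magnus1_nil mulmx0 !addr0 !mulmxDr !trmx_delta_mul.
move: (delta_mx i i : 'M['F_2]_m) (delta_mx j j : 'M['F_2]_m) => p q.
move: (delta_mx i j : 'M['F_2]_m) (delta_mx j i : 'M['F_2]_m) => u v.
transitivity (u + v + ((p + p) + (q + q) + (u + u)))%R; last by rewrite !addFF2 !addr0.
by apply/matrixP => a b; rewrite !mxE; ring.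
Qed.

Lemma magnus1_squares n : magnus1 (squares_word n) = 0%R.
Proof. by rewrite magnus1_flatten big1 // => i _; rewrite magnus1_square. Qed.

Lemma magnus2_squares n : magnus2 (squares_word n) = 1%:M%R.
Proof.
rewrite magnus2_flatten0 => [|i]; last exact: magnus1_square.
under eq_bigr => i _ do rewrite magnus2_square.
rewrite big_enum /=; apply/matrixP => a b.
rewrite summxE (bigD1 a) //= !mxE eqxx big1 ?addr0 => [|i ia].
  by rewrite eq_sym.
by rewrite mxE eq_sym (negbTE ia).
Qed.

Lemma magnus1_commutators n : magnus1 (commutators_word n) = 0%R.
Proof. by rewrite magnus1_flatten big1 // => i _; rewrite magnus1_comm. Qed.

Lemma magnus2_commutators n : magnus2 (commutators_word n) =
  (\sum_i (delta_mx (ord_even i) (ord_odd i) + delta_mx (ord_odd i) (ord_even i)))%R.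
Proof.
rewrite magnus2_flatten0 => [|i]; last exact: magnus1_comm.
under eq_bigr => i _ do rewrite magnus2_comm.
by rewrite big_enum.
Qed.

(** * Retracts of free groups *)

Section RingWords.
Local Open Scope ring_scope.
Variables (A : pzRingType) (m : nat) (a b : 'I_m -> A).
Hypotheses (ab : forall i, a i * b i = 1) (ba : forall i, b i * a i = 1).

Definition ring_letter (l : 'I_m * bool) : A := if l.2 then b l.1 else a l.1.

Definition ring_word (w : word m) : A := \prod_(l <- w) ring_letter l.

Lemma ring_word_nil : ring_word [::] = 1.
Proof. by rewrite /ring_word big_nil. Qed.

Lemma ring_word_cons l w : ring_word (l :: w) = ring_letter l * ring_word w.
Proof. by rewrite /ring_word big_cons. Qed.

Lemma ring_word_cat w u : ring_word (w ++ u) = ring_word w * ring_word u.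
Proof. by rewrite /ring_word big_cat. Qed.

Lemma ring_word_eq w u : pres_eq [::] w u -> ring_word w = ring_word u.
Proof.
elim=> // {w u} [w1 w2 w3 _ -> _ -> //|w1 w2 u1 u2 _ h|i c].
  by rewrite !ring_word_cat h.
by rewrite !ring_word_cons ring_word_nil mulr1; case: c; rewrite /ring_letter /=.
Qed.

Hypothesis a_even : forall i, exists c, a i = 1 + c *+ 2.
Hypothesis b_even : forall i, exists c, b i = 1 + c *+ 2.

Lemma ring_word_even w : exists c, ring_word w = 1 + c *+ 2.
Proof.
elim: w => [|l w [c cE]]; first by exists 0; rewrite ring_word_nil mul0rn addr0.
have [d dE] : exists d, ring_letter l = 1 + d *+ 2 by rewrite /ring_letter; case: l.2.
exists (c + d + d * c *+ 2); rewrite ring_word_cons cE dE.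
rewrite mulrDl mul1r mulrDr mulr1 -!addrA; congr (_ + _).
by rewrite mulrnAl mulrnAr !mulrnDl -!addrA.
Qed.

Variable W : 'I_m -> word m.
Hypothesis W_id : word_mx W = 1%:M.
Hypothesis W_idem : forall u,
  ring_word (subst_word W (subst_word W u)) = ring_word (subst_word W u).

Definition ring_pair (u : word m) : A * A := (ring_word u, ring_word (subst_word W u)).

Lemma ring_pair_cons l u : ring_pair (l :: u) = ring_pair [:: l] * ring_pair u.
Proof.
by rewrite /ring_pair ring_word_cons subst_word_cons ring_word_cat /subst_word /= cats0
   [ring_word [:: l]]ring_word_cons ring_word_nil mulr1.
Qed.

(* The image of the powers of the kernel of [Z[F] -> F_2] under the pair formed
   by a representation and its composition with the endomorphism. *)
Inductive filtration : nat -> A * A -> Prop :=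
| filtration_one : filtration 0 1
| filtration_two : filtration 1 2%:R
| filtration_word u : filtration 1 (ring_pair u - 1)
| filtration_add i z t : filtration i z -> filtration i t -> filtration i (z + t)
| filtration_opp i z : filtration i z -> filtration i (- z)
| filtration_mul i j z t : filtration i z -> filtration j t -> filtration (i + j) (z * t)
| filtration_weak i z : filtration i.+1 z -> filtration i z.

Lemma filtration_sub i z t : filtration i z -> filtration i t -> filtration i (z - t).
Proof. by move=> hz ht; apply: filtration_add => //; apply: filtration_opp. Qed.

Lemma filtration_pair u : filtration 0 (ring_pair u).
Proof.
rewrite -[ring_pair u](subrK 1); apply: filtration_add; last exact: filtration_one.
exact/filtration_weak/filtration_word.
Qed.

Lemma filtration0 i : filtration i 0.
Proof.
elim: i => [|i IHi]; first by rewrite -(subrr 1); apply: filtration_sub; apply: filtration_one.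
rewrite -[0](mul0r 2%:R) -addn1; apply: filtration_mul => //; exact: filtration_two.
Qed.

Lemma filtration_mulrn i z n : filtration i z -> filtration i (z *+ n).
Proof.
move=> hz; elim: n => [|n IHn]; first exact: filtration0.
by rewrite mulrS; apply: filtration_add.
Qed.

Lemma filtration_sum i (I : Type) (s : seq I) (F : I -> A * A) :
  (forall k, filtration i (F k)) -> filtration i (\sum_(k <- s) F k).
Proof.
move=> hF; elim: s => [|k s IHs]; first by rewrite big_nil; apply: filtration0.
by rewrite big_cons; apply: filtration_add.
Qed.

(** The generators 2 and [ring_pair u - 1] have even first coordinate, so step [i] carries [i]
    factors 2. *)
Lemma filtration_dvd i z : filtration i z -> exists c, z.1 = c *+ 2 ^ i.
Proof.
elim=> {i z} [||u|i z t _ [c zE] _ [d tE]|i z _ [c zE]|i j z t _ [c zE] _ [d tE]|i z _ [c zE]].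
- by exists 1.
- by exists 1.
- have [c cE] := ring_word_even u; exists c; rewrite /= cE.
  by rewrite addrAC subrr add0r.
- by exists (c + d); rewrite /= zE tE mulrnDl.
- by exists (- c); rewrite /= zE mulNrn.
- by exists (c * d); rewrite /= zE tE mulrnAl mulrnAr -mulrnA expnD mulnC.
- by exists (c *+ 2); rewrite zE expnS mulrnA.
Qed.

Let gen i := ring_pair [:: (i, false)] - 1.

(** Modulo the second step [u - 1] is additive, by [p q - 1 = (p - 1)(q - 1) + (p - 1) + (q - 1)],
    and an inverse letter counts as the letter. *)
Lemma filtration_letters u :
  filtration 2 (ring_pair u - 1 - \sum_(l <- u) gen l.1).
Proof.
elim: u => [|l u IHu].
  rewrite big_nil subr0 /ring_pair ring_word_nil subrr; exact: filtration0.
have letterP : filtration 2 (ring_pair [:: l] - 1 - gen l.1).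
  case: l => i [] /=; last by rewrite subrr; apply: filtration0.
  have e : ring_pair [:: (i, false)] * ring_pair [:: (i, true)] = 1.
    rewrite -ring_pair_cons; congr (_, _).
      by rewrite (ring_word_eq (pres_cancel _ i false)) ring_word_nil.
    rewrite /subst_word /= cats0 /subst_letter /=.
    by rewrite (ring_word_eq (cat_word_inv_free _)) ring_word_nil.
  (* With [x y = 1], [(y - 1) - (x - 1) = -(x - 1)(x + 1) y], and [x + 1 = (x - 1) + 2] lies in the
     first step. *)
  have -> : ring_pair [:: (i, true)] - 1 - gen i =
     - (gen i * (gen i + 2%:R) * ring_pair [:: (i, true)]).
    rewrite /gen; move: (ring_pair _) (ring_pair _) e => y x e.
    rewrite opprB addrA subrK (_ : x - 1 + 2%:R = x + 1); last by rewrite mulr2n addrA subrK.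
    rewrite mulrBl mul1r mulrDr mulr1 opprD addrA addrK mulrBl mul1r -mulrA e mulr1.
    by rewrite opprB.
  apply: filtration_opp; rewrite -[2%N]/(1 + 1 + 0)%N.
  apply: filtration_mul; last exact: filtration_pair.
  apply: filtration_mul; first exact: filtration_word.
  by apply: filtration_add; [exact: filtration_word|exact: filtration_two].
rewrite ring_pair_cons big_cons.
set p := ring_pair [:: l] in letterP *; set q := ring_pair u in IHu *.
have -> : p * q - 1 = (p - 1) * (q - 1) + (p - 1) + (q - 1).
  rewrite -[X in _ + X + _]mulr1 -mulrDr subrK.
  by rewrite mulrBl mul1r addrA subrK.
rewrite opprD addrACA -[_ + (p - 1) - _]addrA.
apply: filtration_add; last exact: IHu.
apply: filtration_add; last exact: letterP.
by apply: (filtration_mul (i := 1) (j := 1)); apply: filtration_word.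
Qed.

Lemma sum_letters_count (V : nmodType) (F : 'I_m -> V) (w : word m) :
  \sum_(l <- w) F l.1 = \sum_i F i *+ count (fun l => l.1 == i) w.
Proof.
elim: w => [|l w IHw]; first by rewrite big_nil big1.
rewrite big_cons IHw /=; under [RHS]eq_bigr => i _ do rewrite mulrnDr.
rewrite big_split /=; congr (_ + _).
by rewrite (bigD1 l.1) //= eqxx big1 ?addr0 // => i; rewrite eq_sym => /negbTE ->.
Qed.

Lemma magnus1_count (w : word m) i : magnus1 w 0 i = (count (fun l => l.1 == i) w)%:R.
Proof.
rewrite /magnus1 (sum_letters_count (fun i => delta_mx 0 i)) summxE (bigD1 i) //=.
rewrite big1 => [|j ji]; first by rewrite addr0 mulmxnE mxE !eqxx.
by rewrite mulmxnE mxE eq_sym (negbTE ji) mul0rn.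
Qed.

(** Twice an element of the first step lies in the second, so only the parities recorded by
    [magnus1] matter. *)
Lemma filtration_eq u u' : magnus1 u = magnus1 u' -> filtration 2 (ring_pair u - ring_pair u').
Proof.
move=> e.
have -> : ring_pair u - ring_pair u' =
   (ring_pair u - 1 - \sum_(l <- u) gen l.1) - (ring_pair u' - 1 - \sum_(l <- u') gen l.1)
   + (\sum_(l <- u) gen l.1 - \sum_(l <- u') gen l.1).
  move: (ring_pair u) (ring_pair u') (\sum_(_ <- u) _) (\sum_(_ <- u') _) => z t s s'.
  by rewrite !opprB [RHS]addrAC !addrA !subrK.
apply: filtration_add; first by apply: filtration_sub; apply: filtration_letters.
rewrite !sum_letters_count -sumrB; apply: filtration_sum => i.
set c := count _ _; set c' := count _ _.
have odd_cc : odd c = odd c'.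
  have : (c%:R = c'%:R :> 'F_2)%R by rewrite -!magnus1_count e.
  by rewrite (natF2 c) (natF2 c'); case: (odd c); case: (odd c').
have half n : filtration 2 (gen i *+ n - gen i *+ odd n).
  rewrite -{1}(odd_double_half n) mulrnDr addrAC subrr add0r -mul2n mulrnA.
  apply: filtration_mulrn; rewrite -mulr_natl.
  apply: (filtration_mul (i := 1) (j := 1)); first exact: filtration_two.
  exact: filtration_word.
have hc := half c; rewrite odd_cc in hc.
rewrite -(subrK (gen i *+ odd c') (gen i *+ c)) -addrA -[X in _ + X]opprB.
exact: filtration_sub.
Qed.

(** Let [e z = (z.2, z.2)], the image of [z] under the idempotent substitution. By [W_id] it
    preserves classes, so [z - e z] lies one step deeper on generators; products follow from [z t -
    e z e t = (z - e z) t + e z (t - e t)]. *)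
Lemma filtration_shift i z : filtration i z -> filtration i.+1 (z - (z.2, z.2)).
Proof.
elim=> {i z} [||u|i z t _ hz _ ht|i z _ hz|i j z t fz hz ft ht|i z _ hz].
- by rewrite subrr; apply: filtration0.
- by rewrite subrr; apply: filtration0.
- rewrite -[(_, _)]/((ring_word (subst_word W u), ring_word (subst_word W u)) - 1).
  rewrite opprB addrA subrK -{2}W_idem; apply: filtration_eq.
  by rewrite magnus1_subst W_id mulmx1.
- rewrite -[(_, _)]/((z.2, z.2) + (t.2, t.2)) opprD addrACA; exact: filtration_add.
- rewrite -[(_, _)]/(- (z.2, z.2)) -opprD; exact: filtration_opp.
- have -> : z * t - ((z * t).2, (z * t).2) =
      (z - (z.2, z.2)) * t + (z.2, z.2) * (t - (t.2, t.2)).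
    rewrite -[((z * t).2, _)]/((z.2, z.2) * (t.2, t.2)).
    by rewrite mulrBl mulrBr addrA subrK.
  apply: filtration_add; first by rewrite -addSn; apply: filtration_mul.
  rewrite -addnS; apply: filtration_mul => //.
  rewrite -[(_, _)](subKr z); apply: filtration_sub => //; exact: filtration_weak.
- exact: filtration_weak.
Qed.

(** The second coordinate of [ring_pair k - 1] is zero, so [filtration_shift] can be iterated
    indefinitely. *)
Lemma ring_word_dvd k i : ring_word (subst_word W k) = 1 ->
  exists c, ring_word k - 1 = c *+ 2 ^ i.
Proof.
move=> rk; suff [c] : exists c, (ring_pair k - 1).1 = c *+ 2 ^ i by exists c.
have z2 : (ring_pair k - 1).2 = 0 by rewrite /= rk subrr.
apply: filtration_dvd; elim: i => [|i IHi]; first exact/filtration_weak/filtration_word.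
by have := filtration_shift IHi; rewrite z2 subr0.
Qed.

End RingWords.

(** * A faithful representation of free groups by integer matrices *)

Section PingPong.
Local Open Scope ring_scope.
Variable m : nat.
Implicit Types (v : 'I_m -> int) (l : 'I_m * bool) (w : word m) (i j k : 'I_m).

Definition rest i v : int := \sum_(j | j != i) v j.

Definition abs_rest i v : int := \sum_(j | j != i) `|v j|.

Definition pp_letter l v j : int :=
  v j + (if j == l.1 then (if l.2 then -8 else 8) * rest l.1 v else 0).

(** The ping-pong region of the letter [l]: its coordinate dominates the others, and its sign
    relative to [rest] records the exponent. *)
Definition pp_state l v : Prop :=
  2 * abs_rest l.1 v < `|v l.1| /\
  (if l.2 then (0 <= v l.1 /\ rest l.1 v <= 0) \/ (v l.1 <= 0 /\ 0 <= rest l.1 v)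
   else (0 <= v l.1 /\ 0 <= rest l.1 v) \/ (v l.1 <= 0 /\ rest l.1 v <= 0)).

Lemma rest_le i v : `|rest i v| <= abs_rest i v.
Proof. exact: ler_norm_sum. Qed.

Lemma rest_letter l v : rest l.1 (pp_letter l v) = rest l.1 v.
Proof. by apply: eq_bigr => j /negbTE h; rewrite /pp_letter h addr0. Qed.

Lemma abs_rest_letter l v : abs_rest l.1 (pp_letter l v) = abs_rest l.1 v.
Proof. by apply: eq_bigr => j /negbTE h; rewrite /pp_letter h addr0. Qed.

(** When the letter repeats, the signs agree and the dominant coordinate does not shrink. For a new
    index, [rest] exceeds half the old dominant coordinate in absolute value, so the factor 8 makes
    the new coordinate dominant with the right sign. *)
Lemma pp_step l l' v : pp_state l v -> l' != flip_letter l ->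
  pp_state l' (pp_letter l' v) /\
  ((l'.1 != l.1) || (2 <= `|v l.1|) -> 2 <= `|pp_letter l' v l'.1|).
Proof.
case: l l' => [k c] [i b]; rewrite /pp_state rest_letter abs_rest_letter /pp_letter /= eqxx.
case=> st sg; rewrite /flip_letter /= xpair_eqE.
have := rest_le i v.
have [->|ik] := eqVneq i k.
  have := rest_le k v.
  move: (rest k v) (abs_rest k v) (v k) st sg => s T a.
  by case: c; case: b => //=; lia.
pose U : int := \sum_(j | (j != i) && (j != k)) `|v j|.
pose u : int := \sum_(j | (j != i) && (j != k)) v j.
have uU : `|u| <= U by exact: ler_norm_sum.
have sE : rest i v = v k + u by rewrite /rest (bigD1 k) // eq_sym.
have TE : abs_rest i v = `|v k| + U by rewrite /abs_rest (bigD1 k) // eq_sym.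
have TkE : abs_rest k v = `|v i| + U.
  by rewrite /abs_rest (bigD1 i) //=; congr (_ + _); apply: eq_bigl => j; rewrite andbC.
move: st; rewrite TkE TE sE; move: U u uU (v k) (v i) {sg sE TE TkE} => U u uU p q.
by case: b; lia.
Qed.

Definition pp_word w v : 'I_m -> int := foldr pp_letter v w.

Definition reduced w : bool := sorted (fun l l' => l' != flip_letter l) w.

Lemma flip_sym (l l' : 'I_m * bool) : (l == flip_letter l') = (l' == flip_letter l).
Proof.
by case: l l' => [i []] [j []]; rewrite /flip_letter !xpair_eqE /= ?andbF ?andbT // eq_sym.
Qed.

(** A basis vector is an admissible start for either sign when its index differs from that of the
    last letter, which acts first. The bound 2 shows that the image is not a basis vector. *)
Lemma pp_reduced l w k : reduced (l :: w) -> (last l w).1 != k ->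
  let v := pp_word (l :: w) (fun j => (j == k)%:R) in
  pp_state l v /\ 2 <= `|v l.1|.
Proof.
elim: w l => [|l' w IHw] l /=.
  move=> _ lk.
  have st c : pp_state (k, c) (fun j => (j == k)%:R).
    have r0 : rest k (fun j => (j == k)%:R) = 0 by apply: big1 => j /negbTE ->.
    have a0 : abs_rest k (fun j => (j == k)%:R) = 0 by apply: big1 => j /negbTE ->; rewrite normr0.
    by rewrite /pp_state r0 a0 eqxx; case: c => /=; lia.
  have [|h1 h2] := @pp_step (k, false) l _ (st false).
    by apply: contraNneq lk => ->.
  by split=> //; apply: h2; rewrite lk.
move=> /andP[ll' red] lk; have [st ge2] := IHw l' red lk.
have [|h1 h2] := @pp_step l' l _ st; first by rewrite flip_sym.
by split=> //; apply: h2; rewrite ge2 orbT.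
Qed.

Lemma reducedP w : exists2 w', reduced w' & pres_eq [::] w w'.
Proof.
elim: w => [|l w [w' red e]]; first by exists [::] => //; apply: pres_refl.
have e' := pres_eq_cons l e.
case: w' red e e' => [|l' w'] red e e'; first by exists [:: l].
have [l'E|ll'] := boolP (l' == flip_letter l); last first.
  by exists [:: l, l' & w'] => //=; rewrite ll'.
exists w'; first exact: path_sorted red.
apply: pres_trans e' _; rewrite (eqP l'E).
rewrite -[X in pres_eq _ X _]/([::] ++ [:: l; flip_letter l] ++ w').
rewrite -[X in pres_eq _ _ X]/([::] ++ [::] ++ w').
by apply: pres_cat; case: {+}l => i b; apply: pres_cancel.
Qed.

Definition pp_nil i : 'M[int]_m := \matrix_(a, b) ((a == i) && (b != i))%:R.

Lemma pp_nil2 i : pp_nil i * pp_nil i = 0.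
Proof.
apply/matrixP => a b; rewrite !mxE big1 // => j _; rewrite !mxE.
by case: (j == i); rewrite ?andbF ?mul0r ?mulr0.
Qed.

Definition pp_mx i : 'M[int]_m := 1 + pp_nil i *+ 8.
Definition pp_mxV i : 'M[int]_m := 1 - pp_nil i *+ 8.

Lemma pp_mxK i : pp_mx i * pp_mxV i = 1.
Proof.
rewrite /pp_mx /pp_mxV mulrDl mul1r mulrBr mulr1 mulrnAl mulrnAr pp_nil2 !mul0rn.
by rewrite subr0 addrC addrCA subrr addr0.
Qed.

Lemma pp_mxVK i : pp_mxV i * pp_mx i = 1.
Proof.
rewrite /pp_mx /pp_mxV mulrBl mul1r mulrDr mulr1 mulrnAl mulrnAr pp_nil2 !mul0rn.
by rewrite addr0 addrK.
Qed.

Lemma pp_mx_letter l v :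
  ring_letter pp_mx pp_mxV l *m (\col_j v j) = \col_j pp_letter l v j.
Proof.
have nilE i : pp_nil i *m (\col_j v j) = \col_j (if j == i then rest i v else 0).
  apply/matrixP => a b; rewrite !mxE; case: eqP => [->|ai].
    rewrite /rest [RHS]big_mkcond; apply: eq_bigr => j _; rewrite !mxE eqxx /=.
    by case: (j == i); rewrite ?mul0r ?mul1r.
  by apply: big1 => j _; rewrite !mxE (negbTE (introN eqP ai)) mul0r.
rewrite /ring_letter; case: l => i [];
rewrite /pp_mx /pp_mxV /= ?mulmxBl ?mulmxDl mul1mx ?mulNmx !nilE;
by apply/matrixP => a b; rewrite !mxE /pp_letter; case: eqP => _ /=; ring.
Qed.

Lemma pp_mx_word w v :
  ring_word pp_mx pp_mxV w *m (\col_j v j) = \col_j pp_word w v j.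
Proof.
elim: w => [|l w IHw]; first by rewrite ring_word_nil mul1mx.
by rewrite ring_word_cons -mulmxA IHw pp_mx_letter.
Qed.

Lemma pp_faithful w : (2 <= m)%N -> ring_word pp_mx pp_mxV w = 1 -> pres_eq [::] w [::].
Proof.
move=> m2; have [w' red e] := reducedP w; rewrite (ring_word_eq pp_mxK pp_mxVK e).
case: w' red e => [|l w'] red e w1 //; exfalso.
have [k lk] : exists k, (last l w').1 != k.
  pose k0 : 'I_m := Ordinal (ltnW m2); pose k1 : 'I_m := Ordinal m2.
  by have [->|] := eqVneq (last l w').1 k0; [exists k1|exists k0].
have [_] := pp_reduced red lk.
have := pp_mx_word (l :: w') (fun j => (j == k)%:R); rewrite w1 mul1mx.
move/colP/(_ l.1); rewrite !mxE => <-; by case: eqP.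
Qed.

End PingPong.

Theorem free_retract (G : groupType) m (x : 'I_m -> G) (r : {multiplicative G -> G})
    (W : 'I_m -> word m) :
  presented_by [::] x -> (2 <= m)%N -> (forall g, r (r g) = r g) ->
  (forall i, eval_word x (W i) = r (x i)) -> word_mx W = 1%:M%R ->
  forall g, r g = g.
Proof.
move=> pres m2 idem WP W1 g; have [u <-] := pres.1 g.
have evalW w : eval_word x (subst_word W w) = r (eval_word x w).
  by rewrite eval_subst_word (eq_eval_word w WP) -(gmulf_eval_word x r).
(* [k] measures the failure of [r u = u] and lies in the kernel of [r]. *)
pose k := word_inv (subst_word W u) ++ u.
have rk : r (eval_word x k) = 1.
  by rewrite eval_word_cat eval_word_inv evalW gmulfM multiplicativeV idem mulVg.
have k1 : ring_word (@pp_mx m) (@pp_mxV m) (subst_word W k) = 1%R.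
  rewrite (ring_word_eq (@pp_mxK m) (@pp_mxVK m) (u := [::])) ?ring_word_nil //.
  by apply/pres.2; rewrite evalW rk eval_word_nil.
suff : ring_word (@pp_mx m) (@pp_mxV m) k = 1%R.
  move/(pp_faithful m2)/(pres.2 _ _); rewrite eval_word_nil eval_word_cat eval_word_inv evalW.
  by move/mulg1_eq; rewrite invgK.
apply/eqP; rewrite -subr_eq0; apply/eqP/matrixP => a b; rewrite [RHS]mxE.
have dvd i : exists c, (ring_word (@pp_mx m) (@pp_mxV m) k - 1 = c *+ 2 ^ i)%R.
  apply: (ring_word_dvd (@pp_mxK m) (@pp_mxVK m)) k1 => //.
  - by move=> j; exists (pp_nil j *+ 4)%R; rewrite -mulrnA.
  - by move=> j; exists (- pp_nil j *+ 4)%R; rewrite -mulrnA mulNrn.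
  - move=> w; apply: (ring_word_eq (@pp_mxK m) (@pp_mxVK m)); apply/pres.2.
    by rewrite !evalW idem.
set z := (_ - _)%R in dvd *.
(* The entry is divisible by 2 to the power of its own absolute value, which exceeds it; so it is
   zero. *)
have [c zE] := dvd `|z a b|%N.
have zab : z a b = (c a b *+ 2 ^ `|z a b|)%R by rewrite {1}zE mulmxnE.
have := ltn_expl `|z a b|%N (ltnSn 1).
rewrite {1}zab -mulr_natr natz abszM absz_nat -[X in _ < X]mul1n ltn_pmul2r ?expn_gt0 //.
rewrite ltnS leqn0 absz_eq0 => /eqP c0.
by rewrite zab c0 mul0rn.
Qed.

(** * Balls and density *)

Local Open Scope classical_set_scope.

Section Balls.
Variables (G : groupType) (X : {fset G}).
Implicit Types (g h : G) (s : seq G).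

Lemma is_product_of1 : is_product_of X 0 1.
Proof. by exists [::]; rewrite big_nil. Qed.

Lemma is_product_ofM j k g h :
  is_product_of X j g -> is_product_of X k h -> is_product_of X (j + k) (g * h).
Proof.
move=> [s [<- sX ->]] [t [<- tX ->]]; exists (s ++ t).
by rewrite size_cat all_cat sX tX big_cat.
Qed.

Lemma word_ballP r g :
  word_ball X r g <-> exists2 k, is_product_of X k g & k <= r.
Proof.
split=> [[k [gk _] kr]|[k gk kr]]; first by exists k.
have [|n /asboolP gn nmin] := @ex_minnP (fun k => `[< is_product_of X k g >]).
  by exists k; apply/asboolP.
exists n; last by apply: leq_trans kr; apply/nmin/asboolP.
by split=> // j gj; apply/nmin/asboolP.
Qed.

Lemma word_ball1 r : word_ball X r 1.
Proof. by apply/word_ballP; exists 0; [exact: is_product_of1|]. Qed.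

Lemma word_ballM r r' g h :
  word_ball X r g -> word_ball X r' h -> word_ball X (r + r') (g * h).
Proof.
move=> /word_ballP[j gj jr] /word_ballP[k hk kr]; apply/word_ballP.
by exists (j + k); [exact: is_product_ofM|exact: leq_add].
Qed.

Lemma word_ball_split r r' g : word_ball X (r + r') g ->
  exists a b, [/\ word_ball X r a, word_ball X r' b & g = a * b].
Proof.
move=> /word_ballP[k [s [sk sX ->]] kr].
exists (\prod_(y <- take r s) y), (\prod_(y <- drop r s) y); split.
- apply/word_ballP; exists (size (take r s)); last by rewrite size_take; case: ltnP.
  exists (take r s); split=> //; apply/allP => y /mem_take; exact: (allP sX).
- apply/word_ballP; exists (size (drop r s)); last by rewrite size_drop; lia.
  exists (drop r s); split=> //; apply/allP => y /mem_drop; exact: (allP sX).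
- by rewrite -big_cat cat_take_drop.
Qed.

Lemma word_ball_enum r : exists s, forall g, word_ball X r g -> g \in s.
Proof.
elim: r => [|r [s sP]].
  exists [:: 1] => g /word_ballP[k [t [tk _ ->]]]; rewrite leqn0 -tk => /nilP ->.
  by rewrite big_nil inE.
pose L := enum_fset X ++ [seq y^-1 | y <- enum_fset X].
exists (s ++ [seq y * h | y <- L, h <- s]) => g /word_ballP[k [[|y t] [tk tX ->]]].
  by move=> _; rewrite big_nil mem_cat sP //; apply: word_ball1.
rewrite -tk ltnS => tr; rewrite big_cons mem_cat; apply/orP; right.
move: tX => /= /andP[yX tX]; apply: allpairs_f; last first.
  by apply: sP; apply/word_ballP; exists (size t) => //; exists t.
rewrite mem_cat; case/orP: yX => yX; first by rewrite yX.
by apply/orP; right; apply/mapP; exists y^-1; rewrite ?invgK.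
Qed.

Lemma finite_word_ball r : finite_set (word_ball X r).
Proof.
have [s sP] := word_ball_enum r.
by apply: (@sub_finite_set _ _ [set` s]) => //; exact: finite_seq.
Qed.

End Balls.

Lemma nb_elts_enum (G : groupType) (S : set G) : finite_set S ->
  exists s : seq G, [/\ uniq s, size s = nb_elts S & forall g, (g \in s) <-> S g].
Proof.
move=> fS; exists (enum_fset (fset_set S)); split=> [|//|g]; first exact: fset_uniq.
by rewrite in_fset_set // inE.
Qed.

Lemma nb_elts_leq (G : groupType) (S : set G) (s : seq G) :
  finite_set S -> (forall g, S g -> g \in s) -> nb_elts S <= size s.
Proof.
move=> /nb_elts_enum[t [ut <- tP]] sP; apply: uniq_leq_size ut _ => g /tP; exact: sP.
Qed.

(** * From correcting elements to a density bound *)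

Section Density.
Variables (R : realType) (G : groupType) (X : {fset G}) (S : set G).
Variables (Ts : seq G) (D : nat).
Hypothesis Ts_ball : forall t, t \in Ts -> word_ball X D t.
Hypothesis Ts_avoid : forall g, exists2 t, t \in Ts & ~ S (g * t).

(** A suitable [t] carries each element of the ball of radius [k - D] out of [S] within radius [k],
    at most [size Ts] to one; and the ball of radius [k] is covered by translates of that of radius
    [k - D] by the ball of radius [D]. *)
Lemma ball_growth k : D <= k ->
  nb_elts (word_ball X k) <= nb_elts (word_ball X k `\` S) * (size Ts * nb_elts (word_ball X D)).
Proof.
move=> Dk.
have [A [_ sA AP]] := nb_elts_enum (finite_setD S (finite_word_ball X k)).
have [B [_ sB BP]] := nb_elts_enum (finite_word_ball X D).
have : nb_elts (word_ball X (k - D)) <= size [seq a * t^-1 | a <- A, t <- Ts].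
  apply: nb_elts_leq => [|g gk]; first exact: finite_word_ball.
  have [t tT nS] := Ts_avoid g; apply/allpairsP; exists (g * t, t) => /=.
  rewrite mulgK; split=> //; apply/AP; split=> //.
  by rewrite -(subnK Dk); apply: word_ballM => //; apply: Ts_ball.
rewrite size_allpairs sA => le.
have [C [_ sC CP]] := nb_elts_enum (finite_word_ball X (k - D)).
have : nb_elts (word_ball X k) <= size [seq a * b | a <- C, b <- B].
  apply: nb_elts_leq => [|g]; first exact: finite_word_ball.
  rewrite -{1}(subnK Dk) => /word_ball_split[a [b [aC bB ->]]].
  by apply: allpairs_f; [apply/CP|apply/BP].
by rewrite size_allpairs sC sB mulnA => /leq_trans; apply; rewrite leq_mul2r le orbT.
Qed.

Lemma nb_elts_split k :
  nb_elts (S `&` word_ball X k) + nb_elts (word_ball X k `\` S) <= nb_elts (word_ball X k).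
Proof.
have [A [uA <- AP]] := nb_elts_enum (finite_setD S (finite_word_ball X k)).
have [B [uB <- BP]] := nb_elts_enum (finite_setIr S (finite_word_ball X k)).
have [C [_ <- CP]] := nb_elts_enum (finite_word_ball X k).
rewrite -size_cat; apply: uniq_leq_size.
  rewrite cat_uniq uA uB andbT /=; apply/hasPn => g /AP[_ nS].
  by apply/negP => /BP[].
by move=> g; rewrite mem_cat => /orP[/BP[_ /CP]|/AP[/CP]].
Qed.

Lemma asymptotic_density_le (N : nat) :
  size Ts * nb_elts (word_ball X D) <= N ->
  (asymptotic_density R X S <= (1 - N%:R^-1)%R%:E)%E.
Proof.
move=> le_N; rewrite /asymptotic_density /limn_esup /limf_esup.
(* The limsup is at most the supremum over the tail [D <= k], where [ball_growth] applies. *)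
apply: ge_ereal_inf; eexists; first by exists [set k | D <= k]; [exists D|].
apply: ge_ereal_sup => _ [k /= Dk <-]; rewrite lee_fin.
have [E [_ sE EP]] := nb_elts_enum (finite_word_ball X k).
have b_gt0 : 0 < nb_elts (word_ball X k).
  by rewrite -sE; case: E EP {sE} => // /(_ 1) [_ /(_ (word_ball1 X k))].
have := leq_trans (ball_growth Dk) (leq_mul (leqnn _) le_N).
have := nb_elts_split k; move: (nb_elts (S `&` _)) (nb_elts (_ `\` S)) b_gt0.
move: (nb_elts (word_ball X k)) => b a c b0 acb bcN.
have N0 : 0 < N by case: (N) bcN; rewrite ?muln0 // leqNgt b0.
rewrite ler_pdivrMr ?ltr0n // mulrBl mul1r lerBrDr.
apply: (le_trans (y := (a + c)%:R)%R); last by rewrite ler_nat.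
by rewrite natrD lerD2l ler_pdivrMl ?ltr0n // -natrM ler_nat mulnC.
Qed.

End Density.

(** * Test classes *)

Lemma notin_union_proper_retracts (G : groupType) (g0 : G) :
  (forall r : {multiplicative G -> G},
     (forall g, r (r g) = r g) -> r g0 = g0 -> forall g, r g = g) ->
  ~ union_proper_retracts G g0.
Proof.
move=> only_id [H [[_ [r [rH rfix]]] HT] Hg0]; apply: HT.
apply/seteqP; split=> // g _; rewrite -(only_id r _ _ g) //; last exact: rfix.
by move=> h; rewrite rfix.
Qed.

Section Generators.
Local Open Scope ring_scope.
Variables (G : groupType) (m : nat) (rels : seq (word m)) (x : 'I_m -> G).
Hypothesis pres : presented_by rels x.
Hypothesis rels0 : forall s, s \in rels -> magnus1 s = 0.
Variable X : {fset G}.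
Hypothesis genX : generates X.

Lemma magnus1_eval w u : eval_word x w = eval_word x u -> magnus1 w = magnus1 u.
Proof. by move/(pres.2 w u); apply: magnus1_pres_eq. Qed.

(** The classes of a generating set span F_2^m, so [m] of them form a basis; words in these have
    controlled length in [X]. *)
Lemma basis_in_generators :
  exists Y : 'I_m -> word m, (forall i, eval_word x (Y i) \in X) /\ word_mx Y \in unitmx.
Proof.
have /boolp.choice [U UP] : forall g, exists w, eval_word x w = g := pres.1.
set xs := enum_fset X; pose p := size xs.
pose A : 'M['F_2]_(p, m) := \matrix_a magnus1 (U (tnth (in_tuple xs) a)).
have X_sub y : y \in X -> (magnus1 (U y) <= A)%MS.
  move=> yX; have /tnthP[a ->] : y \in in_tuple xs by [].
  by have := row_sub a A; rewrite rowK.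
have prod_sub (s : seq G) w : all (fun y => (y \in X) || (y^-1%g \in X)) s ->
    eval_word x w = (\prod_(y <- s) y)%g -> (magnus1 w <= A)%MS.
  elim: s w => [|y s IHs] w.
    move=> _; rewrite big_nil -(eval_word_nil x) => /magnus1_eval ->.
    by rewrite magnus1_nil sub0mx.
  move=> /= /andP[yX sX]; rewrite big_cons -(UP (\prod_(y <- s) y)%g) => e.
  case/orP: yX => yX.
    rewrite -(UP y) -eval_word_cat in e; rewrite (magnus1_eval e) magnus1_cat.
    by apply: addmx_sub; [exact: X_sub|exact: IHs].
  rewrite -[y]invgK -(UP y^-1%g) -eval_word_inv -eval_word_cat in e.
  rewrite (magnus1_eval e) magnus1_cat magnus1_inv.
  by apply: addmx_sub; [exact: X_sub|exact: IHs].
have full : row_full A.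
  rewrite -sub1mx; apply/row_subP => i; rewrite rowE mulmx1.
  have -> : delta_mx 0 i = magnus1 [:: (i, false)] by rewrite magnus1_cons magnus1_nil addr0.
  have [k [s [_ sX e]]] := genX (eval_word x [:: (i, false)]).
  exact: prod_sub sX e.
exists (fun i => U (tnth (in_tuple xs) (fullrankfun full i))); split.
  by move=> i; rewrite UP; exact: mem_tnth.
have -> : word_mx (fun i => U (tnth (in_tuple xs) (fullrankfun full i))) =
   rowsub (fullrankfun full) A.
  by apply/row_matrixP => i; rewrite row_rowsub !rowK.
exact: fullrowsub_unit.
Qed.

End Generators.

(** * Short words with prescribed terms of degree one and two *)

Section ShortWords.
Variable m : nat.
Implicit Types (c d : 'I_m -> bool).

(** [b1] is the class; [b2] toggles the diagonal entry in degree two without changing it, by passing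
    from [x_i] to its inverse or from the empty word to a square. *)
Definition letter_word (b1 b2 : bool) (i : 'I_m) : word m :=
  if b1 then [:: (i, b2)] else if b2 then [:: (i, false); (i, false)] else [::].

Definition class_word c d : word m := flatten [seq letter_word (c i) (d i) i | i <- enum 'I_m].

Lemma magnus1_class_word c d : magnus1 (class_word c d) = (\row_i (c i)%:R)%R.
Proof.
rewrite magnus1_flatten big_enum /=.
have -> : (\sum_i magnus1 (letter_word (c i) (d i) i) = \sum_i (c i)%:R *: delta_mx 0 i)%R.
  apply: eq_bigr => i _; rewrite /letter_word; case: (c i) => /=.
    by rewrite magnus1_cons magnus1_nil addr0 scale1r.
  by rewrite scale0r; case: (d i); rewrite ?magnus1_square ?magnus1_nil.
by rewrite [RHS]row_sum_delta; apply: eq_bigr => i _; rewrite mxE.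
Qed.

Lemma magnus2_class_word c d :
  magnus2 (class_word c d)
  = (magnus2 (class_word c (fun=> false)) + diag_mx (\row_i (d i)%:R))%R.
Proof.
have -> : diag_mx (\row_i (d i)%:R)%R
    = (\sum_(i <- enum 'I_m) (d i)%:R *: delta_mx i i)%R :> 'M['F_2]_m.
  by rewrite big_enum /= diag_mx_sum_delta; apply: eq_bigr => i _; rewrite mxE.
rewrite /class_word; elim: (enum 'I_m) => [|i s IHs]; first by rewrite big_nil addr0.
have e1 : magnus1 (letter_word (c i) (d i) i) = magnus1 (letter_word (c i) false i).
  rewrite /letter_word; case: (c i); first by rewrite !magnus1_cons.
  by case: (d i); rewrite // magnus1_square magnus1_nil.
have e2 : magnus2 (letter_word (c i) (d i) i)
    = (magnus2 (letter_word (c i) false i) + (d i)%:R *: delta_mx i i)%R.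
  rewrite /letter_word; case: (c i).
    by rewrite !magnus2_letter /= add0r; case: (d i); rewrite ?scale1r ?scale0r.
  by case: (d i); rewrite ?magnus2_square /= ?scale1r ?scale0r ?add0r.
have e3 t : magnus1 (flatten [seq letter_word (c j) (d j) j | j <- t])
    = magnus1 (flatten [seq letter_word (c j) false j | j <- t]).
  rewrite !magnus1_flatten; apply: eq_bigr => j _; rewrite /letter_word; case: (c j).
    by rewrite !magnus1_cons.
  by case: (d j); rewrite // magnus1_square magnus1_nil.
rewrite /= !magnus2_cat IHs e1 e2 e3 big_cons.
move: (_ *m _)%R (magnus2 _) (magnus2 _) (_ *: _)%R (bigop _ _ _) => z a b y s'.
by apply/matrixP => p q; rewrite !mxE; ring.
Qed.

Lemma size_flatten_leq (I : Type) (F : I -> word m) (s : seq I) k :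
  (forall i, size (F i) <= k) -> size (flatten (map F s)) <= size s * k.
Proof.
move=> Fk; elim: s => [|i s IHs] //=.
by rewrite size_cat mulSn leq_add.
Qed.

Lemma size_class_word c d : size (class_word c d) <= m * 2.
Proof.
rewrite -[m in (m * 2)%N](size_enum_ord m); apply: size_flatten_leq => i.
by rewrite /letter_word; case: (c i); case: (d i).
Qed.

Lemma size_class_word0 c : size (class_word c (fun=> false)) <= m.
Proof.
rewrite -[m in _ <= m](size_enum_ord m) -[size (enum _)]muln1.
by apply: size_flatten_leq => i; rewrite /letter_word; case: (c i).
Qed.

(** Squares realise diagonal entries and commutators the symmetric off-diagonal pairs; having zero
    class, their degree-two parts add up. *)
Lemma symmetric_word (C : 'M['F_2]_m) : C^T%R = C ->
  exists w : word m, [/\ magnus1 w = 0%R, magnus2 w = C & size w <= m * m * 4].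
Proof.
move=> symC.
pose F (p : 'I_m * 'I_m) : word m :=
  if C p.1 p.2 == 0%R then [::]
  else if p.1 == p.2 then [:: (p.1, false); (p.1, false)]
  else if p.1 < p.2 then comm_word p.1 p.2 else [::].
have F0 p : magnus1 (F p) = 0%R.
  rewrite /F; case: eqP => _; first by rewrite magnus1_nil.
  case: eqP => _; first by rewrite magnus1_square.
  by case: ltnP; rewrite ?magnus1_comm ?magnus1_nil.
exists (flatten [seq F p | p <- enum {: 'I_m * 'I_m}]); split.
- by rewrite magnus1_flatten big1.
- rewrite (magnus2_flatten0 _ F0) big_enum /=.
  rewrite -(pair_bigA _ (fun i j => magnus2 (F (i, j)))) /=.
  have FE i j : magnus2 (F (i, j)) = ((if (i <= j)%N then C i j *: delta_mx i j else 0) +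
      (if (i < j)%N then C j i *: delta_mx j i else 0))%R.
    have -> : C j i = C i j by rewrite -[in RHS]symC mxE.
    rewrite /F /=.
    have [->|->] := F2_cases (C i j).
      by rewrite eqxx !scale0r !if_same addr0.
    rewrite oner_eq0 !scale1r.
    have [->|ij] := eqVneq i j; first by rewrite leqnn ltnn magnus2_square addr0.
    case: ltngtP => [_|_|/val_inj eij]; first by rewrite magnus2_comm.
      by rewrite addr0.
    by rewrite eij eqxx in ij.
  under eq_bigr => i _ do under eq_bigr => j _ do rewrite FE.
  under eq_bigr => i _ do rewrite big_split.
  rewrite big_split /= [X in (_ + X)%R]exchange_big /= -big_split [RHS]matrix_sum_delta /=.
  apply: eq_bigr => i _; rewrite -big_split /=; apply: eq_bigr => j _.
  by case: leqP => _; rewrite ?addr0 ?add0r.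
- rewrite (_ : (m * m)%N = size (enum {: 'I_m * 'I_m})); last first.
    by rewrite -cardE card_prod card_ord.
  apply: size_flatten_leq => -[i j]; rewrite /F.
  by case: eqP => // _; case: eqP => // _; case: ltnP.
Qed.

End ShortWords.

(** Induction by Schur complement: once the lower block is invertible, the remaining diagonal entry
    is free. *)
Lemma add_diag_unit n (A : 'M['F_2]_n) : exists d : 'rV_n, (A + diag_mx d)%R \in unitmx.
Proof.
elim: n A => [|n IHn] A; first by exists 0%R; rewrite unitmxE det_mx00 unitr1.
have [d dU] := IHn (@drsubmx _ 1 n 1 n A).
rewrite -[n.+1]/(1 + n)%N in A dU *.
set B := (_ + _)%R in dU; set K := (ursubmx A *m invmx B)%R.
have KB : (K *m B = ursubmx A)%R by rewrite -mulmxA mulVmx // mulmx1.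
pose s0 := ((ulsubmx A - K *m dlsubmx A) 0 0)%R.
(* This entry turns the Schur complement [s0] into 1. *)
exists (row_mx (1 - s0)%:M d)%R.
rewrite diag_mx_row -[A in (A + _)%R]submxK add_block_mx !addr0 -/B.
suff : (block_mx 1%:M (- K) 0 1%:M *m
   block_mx (ulsubmx A + diag_mx (1 - s0)%:M) (ursubmx A) (dlsubmx A) B)%R \in unitmx.
  by rewrite unitmx_mul => /andP[].
rewrite mulmx_block !mul1mx !mul0mx !add0r !mulNmx KB subrr.
rewrite unitmxE det_lblock unitrM -!unitmxE dU andbT.
rewrite unitmxE det_mx11 addrAC [(_ + diag_mx _)%R 0%R 0%R]mxE -/s0.
by rewrite 2!mxE eqxx !mulr1n addrC subrK unitr1.
Qed.

(** * Elements lying in no proper retract *)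

Section Avoid.
Local Open Scope ring_scope.
Variables (G : groupType) (m : nat) (rels : seq (word m)) (x : 'I_m -> G).
Hypothesis pres : presented_by rels x.
Hypothesis rels0 : forall s, s \in rels -> magnus1 s = 0.

Lemma endomorphism_words (r : {multiplicative G -> G}) :
  exists W : 'I_m -> word m, (forall i, eval_word x (W i) = r (x i)) /\
    forall u, eval_word x (subst_word W u) = r (eval_word x u).
Proof.
have /boolp.choice [U UP] : forall g, exists w, eval_word x w = g := pres.1.
exists (fun i => U (r (x i))); split=> [i|u]; first exact: UP.
rewrite eval_subst_word gmulf_eval_word; apply: eq_eval_word => i; exact: UP.
Qed.

Lemma word_mx_idem (r : {multiplicative G -> G}) W :
  (forall g, r (r g) = r g) ->
  (forall u, eval_word x (subst_word W u) = r (eval_word x u)) ->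
  word_mx W *m word_mx W = word_mx W.
Proof.
move=> idem WP; apply/row_matrixP => i; rewrite row_mul rowK -magnus1_subst.
have := WP [:: (i, false)]; rewrite /subst_word /= cats0 /subst_letter /= => Wi.
by apply: (magnus1_eval pres rels0); rewrite WP Wi idem.
Qed.

End Avoid.

(** If [r] fixes the element, [E^T S E = S] with [S] invertible; so [E] is an invertible idempotent,
    hence 1, and [free_retract] applies. *)
Lemma free_avoid (G : groupType) m (x : 'I_m -> G) (w : word m) :
  presented_by [::] x -> 2 <= m -> magnus1 w = 0%R -> magnus2 w \in unitmx ->
  ~ union_proper_retracts G (eval_word x w).
Proof.
move=> pres m2 w0 w2; apply: notin_union_proper_retracts => r idem rw.
have [W [WP WS]] := endomorphism_words pres r.
have rels0 : forall s : word m, s \in [::] -> magnus1 s = 0%R by [].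
have E2 := word_mx_idem pres rels0 idem WS.
have : magnus2 (subst_word W w) = magnus2 w.
  by apply: magnus2_free_eq; apply/pres.2; rewrite WS rw.
rewrite magnus2_subst0 // => e.
have EU : word_mx W \in unitmx by move: w2; rewrite -e unitmx_mul => /andP[].
apply: (free_retract pres m2 idem WP).
by rewrite -(mulKmx EU (word_mx W)) E2 mulVmx.
Qed.

(** If [E^T E = 0], its diagonal entry [sum_i E_ij^2 = sum_i E_ij] is zero; it is also entry [j] of
    [(1, ..., 1) E], which would be 1 for a fixed element of class [(1, ..., 1)]. *)
Lemma nonorientable_avoid (G : groupType) n (x : 'I_n -> G) (w : word n) :
  presented_by [:: squares_word n] x -> 3 <= n -> magnus1 w = const_mx 1%R ->
  ~ union_proper_retracts G (eval_word x w).
Proof.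
move=> pres n3 w1; apply: notin_union_proper_retracts => r idem rw.
have [W [WP WS]] := endomorphism_words pres r.
have rels0 s : s \in [:: squares_word n] -> magnus1 s = 0%R.
  by rewrite inE => /eqP ->; exact: magnus1_squares.
have [//|] := surface_retract pres (magnus1_squares n) (@dual_squares _ _ x) n3 idem WP.
rewrite magnus2_squares mulmx1 => EE.
have vE : magnus1 (subst_word W w) = magnus1 w.
  by apply: (magnus1_eval pres rels0); rewrite WS rw.
pose j : 'I_n := Ordinal (ltnW (ltnW n3)).
have := congr1 (fun M : 'M['F_2]_n => M j j) EE; rewrite !mxE.
have := congr1 (fun M : 'rV['F_2]_n => M 0%R j) vE; rewrite magnus1_subst w1 !mxE.
under eq_bigr => i _ do rewrite !mxE mul1r.
under [X in _ -> X = _ -> _]eq_bigr => i _ do rewrite !mxE.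
have sq (a : 'F_2) : (a * a = a)%R by have [->|->] := F2_cases a; rewrite ?mul0r ?mul1r.
under [X in _ -> X = _ -> _]eq_bigr => i _ do rewrite sq.
by move=> -> /eqP; rewrite oner_eq0.
Qed.

Lemma partner_subproof n (i : 'I_n.*2) : (if odd i then i.-1 else i.+1) < n.*2.
Proof. by have := ltn_ord i; case: ifP; lia. Qed.

(** The involution exchanging the two generators of each commutator; [J] is its permutation
    matrix. *)
Definition partner n (i : 'I_n.*2) : 'I_n.*2 := Ordinal (partner_subproof i).

Lemma odd_partner n (i : 'I_n.*2) : odd (partner i) = ~~ odd i.
Proof. by rewrite /=; case: ifP; lia. Qed.

Lemma partnerK n : involutive (@partner n).
Proof. by move=> i; apply/val_inj; rewrite /=; do !case: ifP; lia. Qed.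

Lemma magnus2_commutatorsE n :
  magnus2 (commutators_word n) = (\matrix_(i, j) (j == partner i)%:R)%R.
Proof.
rewrite magnus2_commutators; apply/matrixP => a b; rewrite summxE mxE.
have an : a./2 < n by have := ltn_ord a; lia.
rewrite (bigD1 (Ordinal an)) //= big1 => [|i ia].
  rewrite !mxE addr0 -!val_eqE /=; have [oa|ea] := boolP (odd a).
    rewrite (_ : (_ == a./2.*2) = false) /=; last by lia.
    by rewrite add0r (_ : (val a == _) = true) /=; [congr (nat_of_bool _)%:R%R|]; lia.
  rewrite (_ : (_ == a./2.*2) = true) /=; last by lia.
  by rewrite (_ : (val a == _) = false) /= ?addr0; [congr (nat_of_bool _)%:R%R|]; lia.
move: ia; rewrite !mxE -!val_eqE /= => ia.
have h1 : (a == i.*2 :> nat) = false by apply/negbTE; lia.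
have h2 : (a == i.*2.+1 :> nat) = false by apply/negbTE; lia.
by rewrite h1 h2 addr0.
Qed.

Lemma commutators_mxK n :
  (magnus2 (commutators_word n) *m magnus2 (commutators_word n) = 1%:M)%R.
Proof.
rewrite magnus2_commutatorsE; apply/matrixP => a b; rewrite !mxE (bigD1 (partner a)) //=.
rewrite !mxE eqxx mul1r partnerK big1 ?addr0 => [|j ja]; first by rewrite eq_sym.
by rewrite !mxE (negbTE ja) mul0r.
Qed.

(** For [n >= 2] this diagonal, with [n + 1] ones, has rank above [n] both alone and after adding
    [J]. *)
Definition test_row n : 'rV['F_2]_n.*2 := (\row_i (~~ odd i || (i == 1 :> nat))%:R)%R.

Lemma rank_mxsub (F : fieldType) m n p q (f : 'I_p -> 'I_m) (g : 'I_q -> 'I_n) (A : 'M[F]_(m, n)) :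
  \rank (mxsub f g A) <= \rank A.
Proof.
rewrite -[A in mxsub f g A]mulmx1 mxsub_mul; apply: leq_trans (mxrankM_maxl _ _) _.
by rewrite rowsubE; apply: mxrankM_maxr.
Qed.

Lemma rank_test0 n : 0 < n -> n < \rank (diag_mx (test_row n)).
Proof.
move=> n0.
have fP (i : 'I_n.+1) : (if i < n then i.*2 else 1%N) < n.*2 by have := ltn_ord i; case: ifP; lia.
pose f i := Ordinal (fP i).
apply: leq_trans (rank_mxsub f f _).
rewrite (_ : mxsub f f _ = 1%:M)%R ?mxrank1 //.
apply/matrixP => i j; rewrite !mxE.
have -> : (f i == f j) = (i == j).
  rewrite -!val_eqE /=; have := ltn_ord i; have := ltn_ord j.
  by case: ifP; case: ifP; lia.
rewrite (_ : (~~ _ || _) = true) //=.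
by case: ifP => _ //; rewrite odd_double.
Qed.

(** Up to a rank-one matrix at index 1 this is [ev + J], made of invertible blocks with rows
    [(1, 1)] and [(1, 0)]. *)
Lemma rank_test1 n : n.*2.-1 <= \rank (diag_mx (test_row n) + magnus2 (commutators_word n))%R.
Proof.
case: n => [|n] //.
set J := magnus2 _; pose b1 : 'I_n.+1.*2 := @Ordinal n.+1.*2 1 isT.
pose ev : 'rV['F_2]_n.+1.*2 := (\row_i (~~ odd i)%:R)%R.
pose od : 'rV['F_2]_n.+1.*2 := (\row_i (odd i)%:R)%R.
have testE : diag_mx (test_row n.+1) = (diag_mx ev + delta_mx b1 b1)%R.
  apply/matrixP => i j; rewrite !mxE; have [<-|ij] := eqVneq i j; last first.
    rewrite !mulr0n add0r; case: eqP => // ib; case: eqP => // jb.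
    by rewrite ib jb eqxx in ij.
  rewrite !mulr1n andbb -[i == b1]val_eqE /=.
  by case: eqP => [->|_] /=; rewrite ?add0r // orbF addr0.
have unitE : ((diag_mx ev + J) *m (J + diag_mx od) = 1%:M)%R.
  rewrite mulmxDl !mulmxDr commutators_mxK /J magnus2_commutatorsE.
  rewrite !mul_diag_mx mul_mx_diag; apply/matrixP => a b; rewrite !mxE.
  rewrite -[RHS]addr0 -(addF2 ((~~ odd a)%:R * (b == partner a)%:R)%R).
  have -> : ((b == partner a)%:R * (odd b)%:R = (~~ odd a)%:R * (b == partner a)%:R :> 'F_2)%R.
    by case: eqP => [->|_]; rewrite ?mul0r ?mulr0 // odd_partner mulrC.
  have -> : ((~~ odd a)%:R * ((odd a)%:R *+ (a == b)) = 0 :> 'F_2)%R.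
    by case: (odd a); rewrite ?mul0r ?mul0rn ?mulr0.
  by rewrite addr0; ring.
have full : \rank (diag_mx ev + J)%R = n.+1.*2.
  apply/eqP; rewrite -/(row_free _) row_free_unit.
  have : ((diag_mx ev + J) *m (J + diag_mx od))%R \in unitmx by rewrite unitE unitmx1.
  by rewrite unitmx_mul => /andP[].
have : n.+1.*2 <= \rank (diag_mx (test_row n.+1) + J)%R
    + \rank (delta_mx b1 b1 : 'M['F_2]_n.+1.*2)%R.
  rewrite -[X in X <= _]full -(addrK (delta_mx b1 b1) (diag_mx ev)) -testE opprF2 addrAC.
  exact: mxrank_add.
by rewrite mxrank_delta; lia.
Qed.

(** [E^T J E = 0] with [J] invertible gives rank [E] at most [n]. A fixed element would satisfy
    [E^T S E = S + c J], with [c] the number of relators modulo 2, but both possible right-hand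
    sides have rank above [n]. *)
Lemma orientable_avoid (G : groupType) n (x : 'I_n.*2 -> G) (w : word n.*2) :
  presented_by [:: commutators_word n] x -> 2 <= n ->
  magnus1 w = 0%R -> magnus2 w = diag_mx (test_row n) ->
  ~ union_proper_retracts G (eval_word x w).
Proof.
move=> pres n2 w0 w2; apply: notin_union_proper_retracts => r idem rw.
have [W [WP WS]] := endomorphism_words pres r.
have n3 : 2 < n.*2 by lia.
have J0 := magnus1_commutators n.
have [//|] := surface_retract pres J0 (@dual_commutators _ _ x) n3 idem WP.
set J := magnus2 _; set E := word_mx W => EJE.
have JU : J \in unitmx.
  have : (J *m J)%R \in unitmx by rewrite commutators_mxK unitmx1.
  by rewrite unitmx_mul => /andP[].
have rE : \rank E <= n.
  have := mxrank_mul_min (E^T *m J)%R E; rewrite EJE mxrank0.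
  have -> : \rank (E^T *m J)%R = \rank E by rewrite mxrankMfree ?row_free_unit // mxrank_tr.
  by lia.
have [|gs [_ mg]] := pres_eq_chain pres J0 r (w := subst_word W w) (u := w).
  by apply/pres.2; rewrite WS rw.
have rS : \rank (magnus2 w + (size gs)%:R *: J)%R <= n.
  rewrite -mg magnus2_subst0 // -mulmxA; apply: leq_trans rE.
  by rewrite mulmxA; apply: mxrankM_maxr.
have [c0|c1] := F2_cases (size gs)%:R%R; move: rS; rewrite w2.
  by rewrite c0 scale0r addr0 leqNgt rank_test0 //; lia.
by rewrite c1 scale1r => h; have := leq_trans (rank_test1 n) h; lia.
Qed.

(** * Moving an arbitrary element into a test class *)

Section Corrections.
Local Open Scope ring_scope.
Variables (m : nat) (Y : 'I_m -> word m).
Hypothesis Y_unit : word_mx Y \in unitmx.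

Lemma row_bits (v : 'rV['F_2]_m) : exists c : {ffun 'I_m -> bool}, v = \row_i (c i)%:R.
Proof.
exists [ffun i => v 0 i == 1]; apply/rowP => i; rewrite mxE ffunE.
by have [->|->] := F2_cases (v 0 i).
Qed.

(** The bits [d] do not affect the class, so [c] is fixed first and [d] stays free for degree
    two. *)
Lemma class_correction (u : word m) (v : 'rV['F_2]_m) :
  exists c : {ffun 'I_m -> bool}, forall d,
    magnus1 (u ++ subst_word Y (class_word c d)) = v.
Proof.
have [c cE] := row_bits ((v - magnus1 u) *m invmx (word_mx Y)).
exists c => d; rewrite magnus1_cat magnus1_subst magnus1_class_word -cE mulmxKV //.
by rewrite addrC subrK.
Qed.

Lemma magnus2_correction (u t t' : word m) (C : 'M['F_2]_m) :
  magnus1 t = magnus1 t' -> magnus2 t = magnus2 t' + C ->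
  magnus2 (u ++ subst_word Y t)
  = magnus2 (u ++ subst_word Y t') + (word_mx Y)^T *m C *m word_mx Y.
Proof.
move=> e1 e2; rewrite !magnus2_cat !magnus1_subst !magnus2_subst e1 e2.
rewrite !(sum_letters (fun i => magnus2 (Y i))) e1 mulmxDr mulmxDl.
set A := _ *m word_mx Y; set B := _ *m word_mx Y; set C' := _^T *m _.
move: A B C' => A B C'; move: (bigop _ _ _) (magnus2 _) => S0 U.
by apply/matrixP => i j; rewrite !mxE; ring.
Qed.

Lemma unit_correction (u : word m) (c : {ffun 'I_m -> bool}) :
  exists d : {ffun 'I_m -> bool}, magnus2 (u ++ subst_word Y (class_word c d)) \in unitmx.
Proof.
set YM := word_mx Y; pose S0 := magnus2 (u ++ subst_word Y (class_word c (fun=> false))).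
have [v vU] := add_diag_unit ((invmx YM)^T *m S0 *m invmx YM).
have [d dE] := row_bits v; exists d.
rewrite (@magnus2_correction u _ (class_word c (fun=> false)) (diag_mx v)) -/S0 -/YM.
- have -> : S0 + YM^T *m diag_mx v *m YM =
     YM^T *m ((invmx YM)^T *m S0 *m invmx YM + diag_mx v) *m YM.
    rewrite mulmxDr mulmxDl; congr (_ + _).
    by rewrite !mulmxA -trmx_mul mulVmx // trmx1 mul1mx mulmxKV.
  by rewrite !unitmx_mul vU unitmx_tr Y_unit.
- by rewrite !magnus1_class_word.
- by rewrite magnus2_class_word dE.
Qed.

(** With class zero, the degree-two part is symmetric by [magnus2_sym]; its difference with [S],
    after undoing the congruence by [word_mx Y], is realised by [symmetric_word]. *)
Lemma symmetric_correction (u : word m) (S : 'M['F_2]_m) : S^T = S ->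
  exists t : word m, [/\ magnus1 (u ++ subst_word Y t) = 0,
    magnus2 (u ++ subst_word Y t) = S & (size t <= m + m * m * 4)%N].
Proof.
move=> symS; set YM := word_mx Y.
have [c cP] := class_correction u 0; pose t0 := class_word c (fun=> false).
pose S0 := magnus2 (u ++ subst_word Y t0).
have symS0 : S0^T = S0.
  have := magnus2_sym (u ++ subst_word Y t0); rewrite -/S0 cP trmx0 mul0mx linear0 add0r.
  by move/eqP; rewrite addr_eq0 opprF2 => /eqP.
have [|w [w0 w2 sw]] := @symmetric_word _ ((invmx YM)^T *m (S - S0) *m invmx YM).
  by rewrite !trmx_mul trmxK linearB /= symS symS0 mulmxA.
exists (t0 ++ w); split.
- rewrite magnus1_cat magnus1_subst magnus1_cat w0 addr0 -magnus1_subst -magnus1_cat.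
  exact: cP.
- rewrite (@magnus2_correction u _ t0 (magnus2 w)) -/S0 -/YM.
  + by rewrite w2 !mulmxA -trmx_mul mulVmx // trmx1 mul1mx mulmxKV // addrC subrK.
  + by rewrite magnus1_cat w0 addr0.
  + by rewrite magnus2_cat w0 mulmx0 addr0.
- by rewrite size_cat leq_add ?size_class_word0.
Qed.

End Corrections.

Lemma word_ball_subst (G : groupType) m (x : 'I_m -> G) (X : {fset G})
    (Y : 'I_m -> word m) (t : word m) k :
  (forall i, eval_word x (Y i) \in X) -> size t <= k ->
  word_ball X k (eval_word x (subst_word Y t)).
Proof.
move=> YX; rewrite eval_subst_word => tk; apply/word_ballP; exists (size t) => //.
exists [seq eval_letter (fun i => eval_word x (Y i)) l | l <- t]; split.
- by rewrite size_map.
- apply/allP => _ /mapP[[i b] _ ->]; rewrite /eval_letter /=.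
  by case: b; rewrite ?invgK YX ?orbT.
- by rewrite /eval_word big_map.
Qed.

(** * The three density bounds *)

Theorem corollary4 (R : realType) (G : groupType) :
  (forall n : nat, 2 <= n -> is_free_of_rank G n ->
     forall X : {fset G}, generates X ->
       (asymptotic_density R X (union_proper_retracts G) <=
        (1 - ((2 ^ n.+1 * (2 ^ n - 1) + 1)
                * nb_elts (word_ball X (3 * n - 2)))%N%:R^-1)%R%:E)%E) /\
  (forall n : nat, 3 <= n -> is_nonorientable_surface_group G n ->
     forall X : {fset G}, generates X ->
       (asymptotic_density R X (union_proper_retracts G) <=
        (1 - (6 ^ (n - 1) * nb_elts (word_ball X (5 * n - 5)))%N%:R^-1)%R%:E)%E) /\
  (forall n : nat, 2 <= n -> is_orientable_surface_group G n ->
     forall X : {fset G}, generates X ->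
       (asymptotic_density R X (union_proper_retracts G) <=
        (1 - (nb_elts (word_ball X (161 * n + 8 * 25 ^ n * (n - 1) * (16 * n + 1) + 33))
                ^ 2)%N%:R^-1)%R%:E)%E).
Proof.
split; [|split] => n n_ge [x pres] X genX.
- have [|Y [YX YU]] := basis_in_generators pres _ genX; first by [].
  apply: (@asymptotic_density_le R G X _ [seq eval_word x (subst_word Y (class_word c d))
      | c : {ffun 'I_n -> bool} <- enum {ffun 'I_n -> bool},
        d : {ffun 'I_n -> bool} <- enum {ffun 'I_n -> bool}] (3 * n - 2)).
  + move=> _ /allpairsP[[c d] [_ _ ->]]; apply: word_ball_subst => //.
    by apply: leq_trans (size_class_word _ _) _; lia.
  + move=> g; have [u <-] := pres.1 g.
    have [c cP] := class_correction YU u 0%R; have [d dP] := unit_correction YU u c.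
    exists (eval_word x (subst_word Y (class_word c d))).
      by apply: allpairs_f; rewrite mem_enum.
    by rewrite -eval_word_cat; apply: free_avoid.
  + rewrite leq_mul2r size_allpairs -cardE card_ffun card_bool card_ord expnS; apply/orP; right.
    (* With [q = 2^n] there are [q^2] correcting words, and [2 q (q - 1) + 1 - q^2 = (q - 1)^2]. *)
    by have := expn_gt0 2 n; move: (2 ^ n)%N => q; nia.
- have [|Y [YX YU]] := basis_in_generators pres _ genX.
    by move=> s; rewrite inE => /eqP ->; exact: magnus1_squares.
  apply: (@asymptotic_density_le R G X _
      [seq eval_word x (subst_word Y (class_word c (fun=> false)))
      | c : {ffun 'I_n -> bool} <- enum {ffun 'I_n -> bool}] (5 * n - 5)).
  + move=> _ /mapP[c _ ->]; apply: word_ball_subst => //.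
    by apply: leq_trans (size_class_word0 _) _; lia.
  + move=> g; have [u <-] := pres.1 g.
    have [c cP] := class_correction YU u (const_mx 1)%R.
    exists (eval_word x (subst_word Y (class_word c (fun=> false)))).
      by apply/mapP; exists c; rewrite ?mem_enum.
    by rewrite -eval_word_cat; apply: nonorientable_avoid.
  + rewrite leq_mul2r size_map -cardE card_ffun card_bool card_ord; apply/orP; right.
    case: n n_ge {x pres Y YX YU} => [|n] // n_ge; rewrite subn1 /= expnS.
    (* For genus [g], here [n.+1], the bound [2^g <= 6^(g-1)] amounts to [2 <= 3^(g-1)]. *)
    rewrite -[6]/(2 * 3)%N expnMn mulnC leq_mul2l; apply/orP; right.
    by case: n n_ge => [|n] // _; rewrite expnS; have := expn_gt0 3 n; lia.
- have [|Y [YX YU]] := basis_in_generators pres _ genX.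
    by move=> s; rewrite inE => /eqP ->; exact: magnus1_commutators.
  (* The correcting set is the whole ball of radius [D], whence the square; the correcting words
     have at most [2 n + 16 n^2] letters, which is below [D]. *)
  set D := (_ + 33)%N; have [Ts [_ sT TP]] := nb_elts_enum (finite_word_ball X D).
  apply: (@asymptotic_density_le R G X _ Ts D).
  + by move=> t /TP.
  + move=> g; have [u <-] := pres.1 g.
    have [|t [t0 t2 st]] := symmetric_correction YU u (S := diag_mx (test_row n)).
      by rewrite tr_diag_mx.
    exists (eval_word x (subst_word Y t)).
      apply/TP; apply: word_ball_subst => //; apply: leq_trans st _.
      by rewrite /D; have := expn_gt0 25 n; move: (25 ^ n)%N => q q0; nia.
    by rewrite -eval_word_cat; apply: orientable_avoid.
  + by rewrite sT expnS expn1.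
Qed.
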